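(* Let $W$ be an irreducible euclidean Coxeter group not of type $\widetilde A_n$, let $w$ be a Coxeter element of $W$, and let $R_0$ be the set of reflections of $W$ that occur in some minimal length factorization of $w$ into reflections of $W$. A reflection $r\in W$ lies in $R_0$ if and only if its fixed hyperplane $\mathrm{Fix}(r)$ contains an axial vertex of $w$.
   Context: $W$ is the group generated by reflections of a euclidean space $E$ in the facets of a euclidean simplex with dihedral angles submultiples of $\pi$, acting properly and cocompactly; its chambers (images of that simplex) form the Coxeter complex, and its diagram $\Gamma$ (an extended Dynkin diagram, here a tree) has a unique bipartition. For a chamber $\sigma$ this splits the reflections in its facets into pairwise-commuting sets $S_0,S_1$; $w_j$ is the product of $S_j$; $F_j$ is the face of $\sigma$ obtained by intersecting $\sigma$ with the hyperplanes of the reflections in $S_j$ and $B_j$ its affine hull; $x_0\in B_0,x_1\in B_1$ are the unique pair of points realizing the distance between $B_0$ and $B_1$. Every Coxeter element $w$ is $w_1w_0$ for a suitable chamber $\sigma$ and suitable labelling of the two bipartition classes; fix such $\sigma$. For $i\in\mathbb Z$ define $F_i,x_i$ via the infinite dihedral group $\langle w_0,w_1\rangle$: $F_{-i}=w_0(F_i)$, $F_{2-i}=w_1(F_i)$, and similarly for $x_i$; let $\sigma_i$ be the image of $\sigma$ under this group containing $x_i$ and $x_{i+1}$ (so $\sigma_0=\sigma$). The $\sigma_i$ are the axial chambers of $w$ and their vertices are the axial vertices of $w$. *)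

(* Defs.v *)
From HB Require Import structures.
From mathcomp Require Import all_boot all_order all_algebra.
From mathcomp Require Import all_classical all_reals all_analysis.

Set Implicit Arguments.
Unset Strict Implicit.
Unset Printing Implicit Defensive.

Import Order.TTheory GRing.Theory Num.Theory.
Local Open Scope ring_scope.
Local Open Scope classical_set_scope.

Definition dotp {R : realType} {n : nat} (x y : 'rV[R]_n) : R := (x *m y^T) 0 0.

Definition refl_map {R : realType} {n : nat} (a : 'rV[R]_n) (c : R)
  : 'rV[R]_n -> 'rV[R]_n :=
  fun x => x - ((2 * (dotp a x - c)) / dotp a a) *: a.

Definition is_reflection {R : realType} {n : nat} (f : 'rV[R]_n -> 'rV[R]_n) : Prop :=
  exists (a : 'rV[R]_n) (c : R), a != 0 /\ f = refl_map a c.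

Definition Fix {R : realType} {n : nat} (f : 'rV[R]_n -> 'rV[R]_n) : set 'rV[R]_n :=
  [set x | f x = x].

Definition affinely_independent {R : realType} {n : nat} (v : 'I_n.+1 -> 'rV[R]_n) : Prop :=
  (\matrix_(i < n) (v (lift ord0 i) - v ord0)) \in unitmx.

Definition simplex {R : realType} {n : nat} (v : 'I_n.+1 -> 'rV[R]_n) : set 'rV[R]_n :=
  [set x | exists l : 'I_n.+1 -> R,
     (forall i, 0 <= l i) /\ \sum_i l i = 1 /\ x = \sum_i l i *: v i].

Definition aff_hull {R : realType} {n : nat} (A : set 'rV[R]_n) : set 'rV[R]_n :=
  [set x | exists (k : nat) (p : 'I_k -> 'rV[R]_n) (l : 'I_k -> R),
     (forall i, A (p i)) /\ \sum_i l i = 1 /\ x = \sum_i l i *: p i].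

Definition facet_reflection {R : realType} {n : nat} (v : 'I_n.+1 -> 'rV[R]_n)
  (i : 'I_n.+1) (f : 'rV[R]_n -> 'rV[R]_n) : Prop :=
  is_reflection f /\ forall j, j != i -> f (v j) = v j.

Definition facet_normal {R : realType} {n : nat} (v : 'I_n.+1 -> 'rV[R]_n)
  (i : 'I_n.+1) (u : 'rV[R]_n) : Prop :=
  u != 0 /\
  (forall j k, j != i -> k != i -> dotp u (v j) = dotp u (v k)) /\
  (forall j, j != i -> dotp u (v j) < dotp u (v i)).

(* all dihedral angles of the simplex are submultiples pi/m of pi
   (the dihedral angle theta between facets with inward normals ui, uj
    satisfies cos theta = - <ui,uj> / (|ui| |uj|)) *)
Definition dihedral_submultiples {R : realType} {n : nat} (v : 'I_n.+1 -> 'rV[R]_n) : Prop :=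
  forall i j : 'I_n.+1, i != j -> exists m : nat, (2 <= m)%N /\
    forall ui uj, facet_normal v i ui -> facet_normal v j uj ->
      dotp ui uj = - cos (pi / m%:R) * Num.sqrt (dotp ui ui * dotp uj uj).

(* the set of maps generated by S under composition (S will consist of involutions,
   so this is the group generated by S) *)
Inductive gen {T : Type} (S : (T -> T) -> Prop) : (T -> T) -> Prop :=
| gen_id : gen S id
| gen_step (f g : T -> T) : S f -> gen S g -> gen S (f \o g).

Definition Wgrp {R : realType} {n : nat} (s : 'I_n.+1 -> 'rV[R]_n -> 'rV[R]_n)
  : ('rV[R]_n -> 'rV[R]_n) -> Prop :=
  gen (fun f => exists i, f = s i).

Definition acts_properly {R : realType} {n : nat} (s : 'I_n.+1 -> 'rV[R]_n -> 'rV[R]_n) : Prop :=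
  forall (x : 'rV[R]_n) (rho : R),
    finite_set [set g | Wgrp s g /\ exists y, dotp (y - x) (y - x) <= rho /\
                                       dotp (g y - x) (g y - x) <= rho].

Definition acts_cocompactly {R : realType} {n : nat} (s : 'I_n.+1 -> 'rV[R]_n -> 'rV[R]_n) : Prop :=
  exists (x : 'rV[R]_n) (rho : R), forall y, exists g, Wgrp s g /\ dotp (g y - x) (g y - x) <= rho.

Definition has_order {T : Type} (f : T -> T) (m : nat) : Prop :=
  iter m f = id /\ forall k, (0 < k < m)%N -> iter k f <> id.

(* W is of type tilde A_n: n = 1, or n >= 2 and the Coxeter diagram is an (n+1)-cycle
   with all labels 3 (m_ij = order of s_i s_j). *)
Definition cyc_adjacent {n : nat} (a b : 'I_n.+1) : bool :=
  (val b == (val a).+1 %% n.+1)%N || (val a == (val b).+1 %% n.+1)%N.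

Definition type_Atilde {R : realType} {n : nat} (s : 'I_n.+1 -> 'rV[R]_n -> 'rV[R]_n) : Prop :=
  (n = 1)%N \/
  ((2 <= n)%N /\ exists f : 'I_n.+1 -> 'I_n.+1, injective f /\
     forall a b : 'I_n.+1, a != b ->
       has_order (s (f a) \o s (f b)) (if cyc_adjacent a b then 3 else 2)%N).

Definition reflection_of {R : realType} {n : nat} (s : 'I_n.+1 -> 'rV[R]_n -> 'rV[R]_n)
  (r : 'rV[R]_n -> 'rV[R]_n) : Prop :=
  Wgrp s r /\ is_reflection r.

Definition compl {T : Type} (l : seq (T -> T)) : T -> T :=
  foldr (fun f g => f \o g) id l.

Definition coxeter_element {R : realType} {n : nat} (v : 'I_n.+1 -> 'rV[R]_n)
  (s : 'I_n.+1 -> 'rV[R]_n -> 'rV[R]_n) (w : 'rV[R]_n -> 'rV[R]_n) : Prop :=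
  exists g, Wgrp s g /\
  exists (r : 'I_n.+1 -> 'rV[R]_n -> 'rV[R]_n) (o : seq 'I_n.+1),
    (forall i, facet_reflection (g \o v) i (r i)) /\
    perm_eq o (enum 'I_n.+1) /\ w = compl [seq r i | i <- o].

Definition refl_factorization {R : realType} {n : nat} (s : 'I_n.+1 -> 'rV[R]_n -> 'rV[R]_n)
  (w : 'rV[R]_n -> 'rV[R]_n) (l : seq ('rV[R]_n -> 'rV[R]_n)) : Prop :=
  (forall l1 f l2, l = l1 ++ f :: l2 -> reflection_of s f) /\ compl l = w.

Definition min_refl_factorization {R : realType} {n : nat} (s : 'I_n.+1 -> 'rV[R]_n -> 'rV[R]_n)
  (w : 'rV[R]_n -> 'rV[R]_n) (l : seq ('rV[R]_n -> 'rV[R]_n)) : Prop :=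
  refl_factorization s w l /\
  forall l', refl_factorization s w l' -> (size l <= size l')%N.

Definition R0 {R : realType} {n : nat} (s : 'I_n.+1 -> 'rV[R]_n -> 'rV[R]_n)
  (w : 'rV[R]_n -> 'rV[R]_n) (r : 'rV[R]_n -> 'rV[R]_n) : Prop :=
  exists l l1 l2, min_refl_factorization s w l /\ l = l1 ++ r :: l2.

(* The data fixing the axial chambers of w:
   - a chamber sigma = g(base simplex), g in W, with facet reflections r i;
   - a labelling b of the bipartition of its Coxeter diagram (edges = non-commuting
     pairs of facet reflections), S_0 = {b = false}, S_1 = {b = true};
   - w = w1 w0 with w_j the product of S_j;
   - x0 in B_0, x1 in B_1 realizing the distance between B_0 and B_1, where
     F_j = sigma /\ (facet hyperplanes of S_j), B_j = affine hull of F_j;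
   - X : int -> E with X 0 = x0, X 1 = x1, X(-i) = w0(X i), X(2-i) = w1(X i). *)
Definition wpart {R : realType} {n : nat} (r : 'I_n.+1 -> 'rV[R]_n -> 'rV[R]_n)
  (b : 'I_n.+1 -> bool) (j : bool) : 'rV[R]_n -> 'rV[R]_n :=
  compl [seq r i | i <- enum 'I_n.+1 & b i == j].

Definition Fface {R : realType} {n : nat} (v : 'I_n.+1 -> 'rV[R]_n)
  (g : 'rV[R]_n -> 'rV[R]_n) (r : 'I_n.+1 -> 'rV[R]_n -> 'rV[R]_n)
  (b : 'I_n.+1 -> bool) (j : bool) : set 'rV[R]_n :=
  simplex (g \o v) `&` [set x | forall i, b i = j -> Fix (r i) x].

Definition axial_setup {R : realType} {n : nat} (v : 'I_n.+1 -> 'rV[R]_n)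
  (s : 'I_n.+1 -> 'rV[R]_n -> 'rV[R]_n) (w : 'rV[R]_n -> 'rV[R]_n)
  (g : 'rV[R]_n -> 'rV[R]_n) (r : 'I_n.+1 -> 'rV[R]_n -> 'rV[R]_n)
  (b : 'I_n.+1 -> bool) (x0 x1 : 'rV[R]_n) (X : int -> 'rV[R]_n) : Prop :=
  Wgrp s g /\
  (forall i, facet_reflection (g \o v) i (r i)) /\
  (forall i j, i != j -> (r i \o r j <> r j \o r i) -> b i != b j) /\
  w = wpart r b true \o wpart r b false /\
  aff_hull (Fface v g r b false) x0 /\ aff_hull (Fface v g r b true) x1 /\
  (forall y0 y1, aff_hull (Fface v g r b false) y0 -> aff_hull (Fface v g r b true) y1 ->
     dotp (x0 - x1) (x0 - x1) <= dotp (y0 - y1) (y0 - y1)) /\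
  X 0 = x0 /\ X 1 = x1 /\
  (forall i : int, X (- i) = wpart r b false (X i)) /\
  (forall i : int, X (2 - i) = wpart r b true (X i)).

(* y is an axial vertex (w.r.t. the setup): a vertex of some sigma_i, i.e. of an image
   h(sigma), h in <w0, w1>, of sigma containing X i and X (i+1) *)
Definition axial_vertex {R : realType} {n : nat} (v : 'I_n.+1 -> 'rV[R]_n)
  (g : 'rV[R]_n -> 'rV[R]_n) (r : 'I_n.+1 -> 'rV[R]_n -> 'rV[R]_n)
  (b : 'I_n.+1 -> bool) (X : int -> 'rV[R]_n) (y : 'rV[R]_n) : Prop :=
  exists (i : int) (h : 'rV[R]_n -> 'rV[R]_n),
    gen (fun f => f = wpart r b false \/ f = wpart r b true) h /\
    (h @` simplex (g \o v)) (X i) /\ (h @` simplex (g \o v)) (X (i + 1)) /\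
    exists k, y = h (g (v k)).

(* Main.v *)
(* Coxeter elements are recovered from sign changes of affine forms.  A mirror of W
   never meets the interior of a chamber, so its affine form has a sign there;
   if the form of t changes sign between a chamber and its image under a product of facet
   reflections, then multiplying that product by t deletes one letter.

   Translating along the axis, every vertical mirror (one not parallel to the axis) is
   crossed, so up to conjugation by w the product t w is a word in which one of the n + 1
   facet reflections, the k-th say, is missing; its only fixed point is then the k-th
   vertex.  Hence t w fixes exactly one point, an axial vertex.  A factorization of w
   containing r has length n + 1 and contains a vertical reflection t at another place;
   moving t to one end leaves n reflections, among them r, whose product fixes exactly one
   point, so each of them fixes that axial vertex.

   Conversely, if r fixes an axial vertex, conjugate by a power of w to make it the k-th
   vertex of the chamber.  The word c without the k-th letter has finite order and no other
   fixed point, so the sum of the form of r over the orbit of c vanishes.  The form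
   therefore changes sign along the orbit, r can be split off c, hence off w.

   The sign property follows from the uniqueness of normal forms: folding points into the chamber by
   reflecting in violated walls terminates by properness and is locally confluent by a
   computation in dihedral groups.

   A cycle in the diagram would make the sum of the unit normals along it vanish, which
   only happens for a cycle through all vertices with all labels 3.  On a forest every
   orientation comes from a height function, and moving sources to the end of the word
   (which conjugates it by a simple reflection) turns any order into a bipartite one. *)
Require Import Defs.
From HB Require Import structures.
From mathcomp Require Import all_boot all_order all_algebra.
From mathcomp Require Import all_classical all_reals all_analysis.
From mathcomp Require Import ring lra zify.
Import Order.TTheory GRing.Theory Num.Theory.
Local Open Scope ring_scope.
Local Open Scope classical_set_scope.

(** * Reflections, isometries and barycentric coordinates *)

Section Geometry.
Set Implicit Arguments.
Unset Strict Implicit.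
Variables (R : realType) (n : nat).
Local Notation E := 'rV[R]_n.
Implicit Types (x y z a b e t : E) (c k : R) (A : 'M[R]_n).

Lemma dotpE x y : dotp x y = \sum_i x 0 i * y 0 i.
Proof. by rewrite /dotp mxE; apply: eq_bigr => i _; rewrite mxE. Qed.

Lemma dotpC x y : dotp x y = dotp y x.
Proof. by rewrite !dotpE; apply: eq_bigr => i _; rewrite mulrC. Qed.

Lemma dotpDl x y z : dotp (x + y) z = dotp x z + dotp y z.
Proof. by rewrite /dotp mulmxDl mxE. Qed.

Lemma dotpZl k x y : dotp (k *: x) y = k * dotp x y.
Proof. by rewrite /dotp -scalemxAl mxE. Qed.

Lemma dotpDr x y z : dotp x (y + z) = dotp x y + dotp x z.
Proof. by rewrite dotpC dotpDl !(dotpC _ x). Qed.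

Lemma dotpZr k x y : dotp x (k *: y) = k * dotp x y.
Proof. by rewrite dotpC dotpZl dotpC. Qed.

Lemma dotpNl x y : dotp (- x) y = - dotp x y.
Proof. by rewrite -scaleN1r dotpZl mulN1r. Qed.

Lemma dotpNr x y : dotp x (- y) = - dotp x y.
Proof. by rewrite -scaleN1r dotpZr mulN1r. Qed.

Lemma dotp0l x : dotp 0 x = 0.
Proof. by rewrite -(scale0r x) dotpZl mul0r. Qed.

Lemma dotp0r x : dotp x 0 = 0.
Proof. by rewrite dotpC dotp0l. Qed.

Lemma dotpBl x y z : dotp (x - y) z = dotp x z - dotp y z.
Proof. by rewrite dotpDl dotpNl. Qed.

Lemma dotpBr x y z : dotp x (y - z) = dotp x y - dotp x z.
Proof. by rewrite dotpDr dotpNr. Qed.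

Lemma dotp_suml (I : Type) (s : seq I) (P : pred I) (F : I -> E) y :
  dotp (\sum_(i <- s | P i) F i) y = \sum_(i <- s | P i) dotp (F i) y.
Proof.
elim/big_rec2: _ => [|i u w _ <-]; [exact: dotp0l | by rewrite dotpDl].
Qed.

Lemma dotp_sumr (I : Type) (s : seq I) (P : pred I) (F : I -> E) y :
  dotp y (\sum_(i <- s | P i) F i) = \sum_(i <- s | P i) dotp y (F i).
Proof. by rewrite dotpC dotp_suml; apply: eq_bigr => i _; rewrite dotpC. Qed.

Lemma dotp_ge0 x : 0 <= dotp x x.
Proof. by rewrite dotpE; apply: sumr_ge0 => i _; rewrite -expr2 sqr_ge0. Qed.

Lemma dotp_eq0 x : (dotp x x == 0) = (x == 0).
Proof.
apply/eqP/eqP => [|->]; last exact: dotp0l.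
rewrite dotpE => /eqP; rewrite psumr_eq0 => [/allP h|i _]; last by rewrite -expr2 sqr_ge0.
apply/rowP => i; rewrite mxE.
by have := h i (mem_index_enum _); rewrite /= mulf_eq0 orbb => /eqP.
Qed.

Lemma dotp_gt0 x : (0 < dotp x x) = (x != 0).
Proof. by rewrite lt_def dotp_ge0 andbT dotp_eq0. Qed.

Lemma dotpBB x y : dotp (x - y) (x - y) = dotp x x - 2 * dotp x y + dotp y y.
Proof. by rewrite dotpBl !dotpBr (dotpC y x); ring. Qed.

Lemma dotp_mulmx x y A : dotp (x *m A) y = dotp x (y *m A^T).
Proof. by rewrite /dotp trmx_mul trmxK mulmxA. Qed.

Definition aff a c x := dotp a x - c.

Lemma affD a c x e : aff a c (x + e) = aff a c x + dotp a e.
Proof. by rewrite /aff dotpDr addrAC. Qed.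

Lemma aff_line a c x k e : aff a c (x + k *: e) = aff a c x + k * dotp a e.
Proof. by rewrite affD dotpZr. Qed.

Lemma affN a c x : aff (- a) (- c) x = - aff a c x.
Proof. by rewrite /aff dotpNl opprB addrC opprK. Qed.

Lemma aff_comb (I : Type) (r : seq I) (P : pred I) (l : I -> R) (p : I -> E) a c :
  \sum_(i <- r | P i) l i = 1 ->
  aff a c (\sum_(i <- r | P i) l i *: p i) = \sum_(i <- r | P i) l i * aff a c (p i).
Proof.
move=> h; rewrite /aff dotp_sumr -[c in LHS]mul1r -h mulr_suml -sumrB.
by apply: eq_bigr => i _; rewrite dotpZr mulrBr.
Qed.

Lemma refl_mapE a c x : refl_map a c x = x - (2 * aff a c x / dotp a a) *: a.
Proof. by []. Qed.

Lemma aff_refl b k a c x :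
  aff b k (refl_map a c x) = aff b k x - 2 * aff a c x / dotp a a * dotp b a.
Proof. by rewrite refl_mapE -scaleNr aff_line mulNr. Qed.

Lemma aff_refl_self a c x : a != 0 -> aff a c (refl_map a c x) = - aff a c x.
Proof. by rewrite -dotp_eq0 => h; rewrite aff_refl divfK //; ring. Qed.

Lemma refl_mapK a c x : a != 0 -> refl_map a c (refl_map a c x) = x.
Proof.
move=> h; rewrite {1}refl_mapE aff_refl_self // refl_mapE -addrA -opprD -scalerDl.
by rewrite mulrN mulNr subrr scale0r subr0.
Qed.

Lemma Fix_refl a c x : a != 0 -> refl_map a c x = x <-> aff a c x = 0.
Proof.
move=> h; rewrite refl_mapE; split => [/eqP|->].
  rewrite subr_eq addrC -subr_eq subrr eq_sym scaler_eq0 (negPf h) orbF.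
  by rewrite mulf_eq0 invr_eq0 dotp_eq0 (negPf h) orbF mulf_eq0 pnatr_eq0 => /eqP.
by rewrite mulr0 mul0r scale0r subr0.
Qed.

Lemma refl_scale k a c : k != 0 -> refl_map (k *: a) (k * c) = refl_map a c.
Proof.
move=> k0; apply/funext => x.
have [->|a0] := eqVneq a 0; first by rewrite scaler0 !refl_mapE !scaler0.
rewrite !refl_mapE scalerA; congr (_ - _ *: _).
have h : dotp a a != 0 by rewrite dotp_eq0.
by rewrite /aff !dotpZl !dotpZr; field; rewrite h k0.
Qed.

Lemma refl_mapN a c : refl_map (- a) (- c) = refl_map a c.
Proof. by rewrite -scaleN1r -[- c]mulN1r refl_scale // oppr_eq0 oner_eq0. Qed.

(** Points are row vectors, so the orthogonal matrix acts on the right; naming it lets forms be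
    pulled back explicitly. *)
Definition rigid (f : E -> E) :=
  exists A t, A *m A^T = 1%:M /\ f = fun x => x *m A + t.

Lemma rigid_id : rigid id.
Proof.
exists 1%:M, 0; split; first by rewrite trmx1 mulmx1.
by apply/funext => x; rewrite mulmx1 addr0.
Qed.

Lemma rigid_comp f g : rigid f -> rigid g -> rigid (f \o g).
Proof.
move=> [A [t [hA ->]]] [B [u [hB ->]]]; exists (B *m A), (u *m A + t); split.
  by rewrite trmx_mul mulmxA -(mulmxA B) hA mulmx1 hB.
by apply/funext => x /=; rewrite mulmxDl mulmxA addrA.
Qed.

Lemma rigid_refl a c : a != 0 -> rigid (refl_map a c).
Proof.
move=> a0; have h : dotp a a != 0 by rewrite dotp_eq0.
(* [B] is twice the orthogonal projection onto the line of [a]: it is symmetric with square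
   [2 *: B], so [1 - B] is orthogonal. *)
pose B := (2 / dotp a a) *: (a^T *m a).
have BT : B^T = B by rewrite /B linearZ /= trmx_mul trmxK.
have BB : B *m B = 2 *: B.
  rewrite /B -scalemxAl -scalemxAr -mulmxA (mulmxA a) (mx11_scalar (a *m a^T)).
  rewrite mul_scalar_mx -scalemxAr !scalerA; congr (_ *: _).
  by rewrite -/(dotp a a); field.
exists (1%:M - B), ((2 * c / dotp a a) *: a); split.
  rewrite linearB /= trmx1 BT mulmxBl !mulmxBr !mulmx1 !mul1mx BB.
  by rewrite scaler_nat mulr2n opprB addrK subrK.
apply/funext => x; rewrite refl_mapE mulmxBr mulmx1 -addrA; congr (_ + _).
rewrite /B -scalemxAr mulmxA (mx11_scalar (x *m a^T)) mul_scalar_mx -/(dotp x a).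
rewrite !scalerA -[- ((2 * _ / _) *: a)]scaleNr -[- ((2 / _ * _) *: a)]scaleNr -scalerDl.
congr (_ *: _).
by rewrite /aff dotpC; field.
Qed.

Lemma rigid_dist f x y : rigid f ->
  dotp (f x - f y) (f x - f y) = dotp (x - y) (x - y).
Proof.
move=> [A [t [hA ->]]].
by rewrite opprD addrACA subrr addr0 -mulmxBl dotp_mulmx -mulmxA hA mulmx1.
Qed.

Lemma rigid_comb f (I : Type) (r : seq I) (P : pred I) (l : I -> R) (p : I -> E) :
  rigid f -> \sum_(i <- r | P i) l i = 1 ->
  f (\sum_(i <- r | P i) l i *: p i) = \sum_(i <- r | P i) l i *: f (p i).
Proof.
move=> [A [t [hA ->]]] h.
rewrite mulmx_suml -[t in LHS]scale1r -h scaler_suml -big_split /=.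
by apply: eq_bigr => i _; rewrite -scalemxAl scalerDr.
Qed.

(** Pulling the form back by [g] keeps the length of its gradient, so reflection and form move
    together; the last clause transports signs. *)
Lemma refl_conj f g a c : rigid g -> cancel g f ->
  exists a' c', [/\ f \o refl_map a c \o g = refl_map a' c',
    a != 0 -> a' != 0 & forall x, aff a c (g x) = aff a' c' x].
Proof.
move=> [A [t [hA ->]]] gK.
have hA' : A^T *m A = 1%:M by apply: mulmx1C.
have aE x : aff a c (x *m A + t) = aff (a *m A^T) (c - dotp a t) x.
  by rewrite /aff dotpDr dotp_mulmx trmxK; ring.
have dE : dotp (a *m A^T) (a *m A^T) = dotp a a.
  by rewrite dotp_mulmx trmxK -mulmxA hA' mulmx1.
exists (a *m A^T), (c - dotp a t); split=> //; last first.
  by rewrite -!dotp_eq0 dE.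
apply/funext => x /=; rewrite -[RHS]gK; congr f.
rewrite !refl_mapE aE dE mulmxBl -scalemxAl -mulmxA hA' mulmx1.
by rewrite addrAC.
Qed.

(** The forms [aff (b i) (c i)] are the barycentric coordinates: walls are their zero sets and the
    simplex is where all are nonnegative. *)
Definition bary (v : 'I_n.+1 -> E) (b : 'I_n.+1 -> E) (c : 'I_n.+1 -> R) :=
  [/\ forall i j, aff (b i) (c i) (v j) = (i == j)%:R,
      forall x, \sum_i aff (b i) (c i) x = 1
    & forall x, x = \sum_i aff (b i) (c i) x *: v i].

Lemma bary_exists v : affinely_independent v ->
  exists (b : 'I_n.+1 -> E) (c : 'I_n.+1 -> R), bary v b c.
Proof.
rewrite /affinely_independent; set M := (\matrix_(i < n) _) => Mu.
pose b0 (i : 'I_n) : E := (col i (invmx M))^T.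
have b0E i x : dotp (b0 i) x = (x *m invmx M) 0 i.
  by rewrite dotpC /dotp trmxK !mxE; apply: eq_bigr => j _; rewrite !mxE.
pose y x := (x - v ord0) *m invmx M.
pose b i := if unlift ord0 i is Some j then b0 j else - \sum_j b0 j.
pose c i := if unlift ord0 i is Some j then dotp (b0 j) (v ord0)
            else - dotp (\sum_j b0 j) (v ord0) - 1.
have bl j x : aff (b (lift ord0 j)) (c (lift ord0 j)) x = y x 0 j.
  by rewrite /aff /b /c liftK -dotpBr b0E.
have bb0 x : aff (b ord0) (c ord0) x = 1 - \sum_j y x 0 j.
  rewrite /aff /b /c unlift_none dotpNl !dotp_suml.
  under [X in _ = 1 - X]eq_bigr => j _ do rewrite -b0E dotpBr.
  rewrite sumrB; ring.
have s1 x : \sum_i aff (b i) (c i) x = 1.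
  by rewrite big_ord_recl bb0 (eq_bigr _ (fun j _ => bl j x)) subrK.
have xE x : x = \sum_i aff (b i) (c i) x *: v i.
  rewrite big_ord_recl bb0; under [X in _ = _ + X]eq_bigr do rewrite bl.
  rewrite scalerBl scale1r scaler_suml addrAC -addrA -sumrB.
  under [X in _ = _ + X]eq_bigr do rewrite -scalerBr.
  have -> : \sum_i y x 0 i *: (v (lift ord0 i) - v ord0) = y x *m M.
    by rewrite mulmx_sum_row; apply: eq_bigr => i _; rewrite rowK.
  by rewrite /y mulmxKV // addrC subrK.
exists b, c; split=> // i j.
have yv (k : 'I_n) : y (v (lift ord0 k)) = delta_mx 0 k.
  have -> : y (v (lift ord0 k)) = row k M *m invmx M by rewrite rowK.
  by rewrite -row_mul mulmxV // rowE mulmx1.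
have y0 : y (v ord0) = 0 by rewrite /y subrr mul0mx.
case: (unliftP ord0 i) => [i'|] ->; case: (unliftP ord0 j) => [j'|] ->.
- by rewrite bl yv mxE eqxx /= (inj_eq lift_inj) eq_sym.
- by rewrite bl y0 mxE.
- rewrite bb0 yv (bigD1 j') //= big1 => [|k kj]; first by rewrite mxE !eqxx addr0 subrr.
  by rewrite mxE eqxx (negPf kj).
- by rewrite bb0 y0 big1 ?subr0 // => k _; rewrite mxE.
Qed.

Section Bary.
Variables (v b : 'I_n.+1 -> E) (c : 'I_n.+1 -> R).
Hypothesis hb : bary v b c.

Lemma bary_vert i j : aff (b i) (c i) (v j) = (i == j)%:R.
Proof. by case: hb. Qed.

Lemma bary_sum1 x : \sum_i aff (b i) (c i) x = 1.
Proof. by case: hb. Qed.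

Lemma bary_recover x : x = \sum_i aff (b i) (c i) x *: v i.
Proof. by case: hb. Qed.

Lemma bary_inj x y : (forall i, aff (b i) (c i) x = aff (b i) (c i) y) -> x = y.
Proof.
by move=> h; rewrite (bary_recover x) (bary_recover y); apply: eq_bigr => i _; rewrite h.
Qed.

Lemma bary_aff a k x : aff a k x = \sum_i aff (b i) (c i) x * aff a k (v i).
Proof. by rewrite {1}(bary_recover x) aff_comb // bary_sum1. Qed.

Lemma bary_aff0 a k : (forall i, aff a k (v i) = 0) -> a = 0.
Proof.
move=> h; have h0 x : aff a k x = 0.
  by rewrite bary_aff big1 // => i _; rewrite h mulr0.
have := h0 (0 + 1 *: a); rewrite aff_line h0 add0r mul1r => /eqP.
by rewrite dotp_eq0 => /eqP.
Qed.

Lemma bary_comb (l : 'I_n.+1 -> R) i : \sum_j l j = 1 ->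
  aff (b i) (c i) (\sum_j l j *: v j) = l i.
Proof.
move=> h; rewrite aff_comb // (bigD1 i) //= bary_vert eqxx mulr1 big1 ?addr0 //.
by move=> j ji; rewrite bary_vert eq_sym (negPf ji) mulr0.
Qed.

Lemma simplexP x : simplex v x <-> forall i, 0 <= aff (b i) (c i) x.
Proof.
split=> [[l [l0 [l1 ->]]] i|h]; first by rewrite bary_comb.
exists (fun i => aff (b i) (c i) x); split=> //; split; first exact: bary_sum1.
exact: bary_recover.
Qed.

Lemma bary_diff i x y :
  aff (b i) (c i) x - aff (b i) (c i) y = dotp (b i) (x - y).
Proof. by rewrite /aff dotpBr; ring. Qed.

Lemma bary_sum_grad : \sum_i b i = 0.
Proof.
apply/eqP; rewrite -dotp_eq0; apply/eqP; set D := \sum_i b i.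
rewrite {1}/D dotp_suml; under eq_bigr do rewrite -[X in dotp _ X]addr0 -(subrr 0).
under eq_bigr => i _ do rewrite addrA addr0 -bary_diff.
by rewrite sumrB !bary_sum1 subrr.
Qed.

(** Pairing with [v i - v j] extracts [l i - l j]; up to a factor, [bary_sum_grad] is thus the only
    linear relation between the gradients. *)
Lemma bary_dep (l : 'I_n.+1 -> R) : \sum_i l i *: b i = 0 -> forall i j, l i = l j.
Proof.
move=> h i j; have : dotp (\sum_k l k *: b k) (v i - v j) = 0 by rewrite h dotp0l.
rewrite dotp_suml; under eq_bigr do rewrite dotpZl -bary_diff !bary_vert mulrBr.
rewrite sumrB (bigD1 i) //= eqxx mulr1 big1 ?addr0; last first.
  by move=> k ki; rewrite (negPf ki) mulr0.
rewrite (bigD1 j) //= eqxx mulr1 big1 ?addr0 => [/eqP|k kj]; last by rewrite (negPf kj) mulr0.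
by rewrite subr_eq0 => /eqP.
Qed.

Lemma bary_grad_neq0 i : (0 < n)%N -> b i != 0.
Proof.
move=> n0; apply/eqP => bi0.
pose j := lift i (Ordinal n0).
have /eqP := bary_diff i (v i) (v j); rewrite !bary_vert bi0 dotp0l eqxx.
by rewrite (negPf (neq_lift i _)) subr0 oner_eq0.
Qed.

(** The form of a reflection fixing the facet vanishes at all vertices but [v i], so it is a nonzero
    multiple of the [i]-th coordinate, and scaling a form keeps its reflection. *)
Lemma bary_facet_refl i f : (0 < n)%N ->
  facet_reflection v i f <-> f = refl_map (b i) (c i).
Proof.
move=> n0; split=> [[[a [k [a0 ->]]] h]|->]; last first.
  split; first by exists (b i), (c i); rewrite bary_grad_neq0.
  move=> j ji; apply/Fix_refl; first exact: bary_grad_neq0.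
  by rewrite bary_vert eq_sym (negPf ji).
have av j : j != i -> aff a k (v j) = 0 by move=> /h /Fix_refl ->.
set m := aff a k (v i).
have aE x : aff a k x = m * aff (b i) (c i) x.
  rewrite bary_aff (bigD1 i) //= big1 ?addr0 1?mulrC // => j ji.
  by rewrite av // mulr0.
(* Comparing the two forms at [0] and at the difference [e] of the gradients gives
   [dotp e e = 0]. *)
have aE' : a = m *: b i.
  apply/eqP; rewrite -subr_eq0 -dotp_eq0; set e := a - _.
  rewrite {1}/e dotpBl dotpZl; have := aE e; have := aE 0.
  rewrite /aff !dotp0r !mulrBr mulr0; lra.
have kE : k = m * c i.
  by have := aE 0; rewrite /aff !dotp0r !sub0r mulrN => /oppr_inj.
have m0 : m != 0 by apply: contraNneq a0 => m0; rewrite aE' m0 scale0r.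
by rewrite aE' kE refl_scale.
Qed.

Lemma bary_rigid g : rigid g ->
  exists (b' : 'I_n.+1 -> E) (c' : 'I_n.+1 -> R), bary (g \o v) b' c' /\
    (forall i j, dotp (b' i) (b' j) = dotp (b i) (b j)) /\
    forall i x, aff (b' i) (c' i) (g x) = aff (b i) (c i) x.
Proof.
move=> ig; case: (ig) => A [t [hA gE]].
have hA' : A^T *m A = 1%:M by apply: mulmx1C.
pose b' i := b i *m A; pose c' i := c i + dotp (b' i) t.
have aE i x : aff (b' i) (c' i) (g x) = aff (b i) (c i) x.
  rewrite gE /aff /c' dotpDr /b' dotp_mulmx -mulmxA hA mulmx1; ring.
have gs x : exists y, x = g y.
  by exists ((x - t) *m A^T); rewrite gE -mulmxA hA' mulmx1 subrK.
exists b', c'; split; last split=> // i j; last first.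
  by rewrite /b' dotp_mulmx -mulmxA hA mulmx1.
split=> [i j|x|x]; first by rewrite aE bary_vert.
  by have [y ->] := gs x; under eq_bigr do rewrite aE; exact: bary_sum1.
have [y ->] := gs x; under eq_bigr do rewrite aE.
by rewrite -rigid_comb ?bary_sum1 // -bary_recover.
Qed.

End Bary.
End Geometry.

(** * Folding onto a chamber *)

Section Gen.
Set Implicit Arguments.
Unset Strict Implicit.

Lemma gen1 (T : Type) (S : (T -> T) -> Prop) f : S f -> gen S f.
Proof. by move=> Sf; apply: (gen_step Sf (gen_id S)). Qed.

Lemma gen_comp (T : Type) (S : (T -> T) -> Prop) f g : gen S f -> gen S g -> gen S (f \o g).
Proof.
by move=> Sf Sg; elim: Sf => // f1 f2 S1 _ IH; apply: (gen_step S1 IH).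
Qed.

Lemma gen_inv (T : Type) (S : (T -> T) -> Prop) f :
  (forall h, S h -> involutive h) -> gen S f ->
  exists g, [/\ gen S g, cancel f g & cancel g f].
Proof.
move=> inv; elim=> [|f1 f2 S1 _ [g [Sg fg gf]]].
  by exists id; split=> //; exact: gen_id.
exists (g \o f1); split.
- exact: gen_comp Sg (gen1 S1).
- by move=> x /=; rewrite inv.
- by move=> x /=; rewrite gf inv.
Qed.

Lemma count_lt (T : eqType) (a1 a2 : pred T) (s : seq T) x :
  subpred a1 a2 -> x \in s -> a2 x -> ~~ a1 x -> (count a1 s < count a2 s)%N.
Proof.
move=> sub; elim: s => // y s IH; rewrite inE => /orP[/eqP <-|xs] a2x a1x /=.
  by rewrite a2x (negPf a1x) add0n add1n ltnS; exact: sub_count.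
have := IH xs a2x a1x; have := sub y.
by case: (a1 y) => [->|_] //; case: (a2 y) => //= h; lia.
Qed.

(** The inverse of one plus the sum of all ratios of the absolute value of [q i] to [p i] serves
    every index at once. *)
Lemma small_step (R : realType) (I : finType) (p q : I -> R) : (forall i, 0 < p i) ->
  exists2 e : R, 0 < e & forall i, e * `|q i| <= p i.
Proof.
move=> p0; pose S := \sum_i `|q i| / p i.
have S0 : 0 <= S by apply: sumr_ge0 => i _; rewrite divr_ge0 // ltW.
have S1 : 0 < S + 1 by rewrite ltr_wpDl.
exists (S + 1)^-1 => [|i]; first by rewrite invr_gt0.
rewrite mulrC ler_pdivrMr // mulrC -ler_pdivrMr //.
apply: (@le_trans _ _ S); last by rewrite lerDl.
rewrite /S (bigD1 i) //= lerDl; apply: sumr_ge0 => j _.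
by rewrite divr_ge0 // ltW // p0.
Qed.
End Gen.

Section Fold.
Set Implicit Arguments.
Unset Strict Implicit.
Variables (R : realType) (n : nat).
Local Notation E := 'rV[R]_n.
Variables (v b : 'I_n.+1 -> E) (c : 'I_n.+1 -> R).
Hypotheses (n0 : (0 < n)%N) (hb : bary v b c).
Local Notation beta i := (aff (b i) (c i)).
Local Notation s := (fun i => refl_map (b i) (c i)).

Lemma W_gen i : Wgrp s (s i).
Proof. by apply: gen1; exists i. Qed.

Lemma W_inv g : Wgrp s g -> exists g', [/\ Wgrp s g', cancel g g' & cancel g' g].
Proof.
apply: gen_inv => h [i ->] x; apply: refl_mapK; exact: (bary_grad_neq0 hb).
Qed.

Lemma W_rigid g : Wgrp s g -> rigid g.
Proof.
elim=> [|f h [i ->] _]; first exact: rigid_id.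
by apply: rigid_comp; apply: rigid_refl; exact: (bary_grad_neq0 hb).
Qed.

(** * Alternating words in two facet reflections *)

Section Dihedral.
Variables (i j : 'I_n.+1) (th : R).
Local Notation norm i := (Num.sqrt (dotp (b i) (b i))).
Local Notation p x i := (aff (b i) (c i) x / norm i).

Fixpoint alternate k (z : E) :=
  if k is k'.+1 then s (if odd k' then j else i) (alternate k' z) else z.

Lemma norm_gt0 l : 0 < norm l.
Proof. by rewrite sqrtr_gt0 dotp_gt0 (bary_grad_neq0 hb). Qed.

Lemma norm_sq l : norm l * norm l = dotp (b l) (b l).
Proof. by rewrite -expr2 sqr_sqrtr // dotp_ge0. Qed.

Lemma naff_refl_self l z : p (s l z) l = - p z l.
Proof. by rewrite aff_refl_self ?mulNr // (bary_grad_neq0 hb). Qed.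

Lemma naff_refl l l' z C : dotp (b l) (b l') = - C * (norm l * norm l') ->
  p (s l z) l' = p z l' + 2 * C * p z l.
Proof.
move=> h; rewrite aff_refl (dotpC (b l')) h.
move: (lt0r_neq0 (norm_gt0 l)) (lt0r_neq0 (norm_gt0 l')) (norm_sq l).
move: (norm l) (norm l') => u u' u0 u'0 <-.
by field; rewrite u0 u'0.
Qed.

Hypothesis hC : dotp (b i) (b j) = - cos th * (norm i * norm j).

Lemma alternate_coord k z :
  sin th * p (alternate k z) (if odd k then j else i) =
    sin (k%:R * th + th) * p z i + sin (k%:R * th) * p z j /\
  sin th * p (alternate k z) (if odd k then i else j) =
    - (sin (k%:R * th) * p z i + sin (k%:R * th - th) * p z j).
Proof.
elim: k => [|k [IH1 IH2]].
  rewrite /= mul0r add0r sub0r sin0 sinN; split; first by rewrite mul0r addr0.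
  by rewrite mul0r add0r mulNr opprK.
have hC' : dotp (b j) (b i) = - cos th * (norm j * norm i).
  by rewrite dotpC hC (mulrC (norm i)).
have e1 : p (alternate k.+1 z) (if odd k.+1 then j else i) =
    p (alternate k z) (if odd k then i else j) +
    2 * cos th * p (alternate k z) (if odd k then j else i).
  rewrite [alternate k.+1 z]/= [odd k.+1]/=.
  by case: (odd k); rewrite /= (@naff_refl _ _ _ (cos th)).
have e2 : p (alternate k.+1 z) (if odd k.+1 then i else j) =
    - p (alternate k z) (if odd k then j else i).
  by rewrite [alternate k.+1 z]/= [odd k.+1]/=; case: (odd k); rewrite /= naff_refl_self.
have rec (y : R) : sin (y + th) = 2 * cos th * sin y - sin (y - th).
  by rewrite sinD sinB; ring.
have -> : k.+1%:R * th = k%:R * th + th by rewrite -natr1 mulrDl mul1r.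
rewrite e1 e2 addrK; split; last by rewrite mulrN IH1.
rewrite mulrDr IH2 (mulrCA (sin th) (2 * cos th)) IH1.
rewrite (rec (k%:R * th + th)) addrK (rec (k%:R * th)); ring.
Qed.

Lemma alternate_span k z : exists u u', alternate k z = z + (u *: b i + u' *: b j).
Proof.
elim: k => [|k [u [u' IH]]]; first by exists 0, 0; rewrite !scale0r !addr0.
rewrite [alternate k.+1 z]/= refl_mapE; set m := _ / _; rewrite IH.
case: (odd k) @m => m.
  by exists u, (u' - m); rewrite scalerBl !addrA.
by exists (u - m), u'; rewrite scalerBl -!addrA (addrC (u' *: _)) !addrA.
Qed.

End Dihedral.

Lemma alternate_braid i j m z : (2 <= m)%N ->
  dotp (b i) (b j) = - cos (pi / m%:R) *
    (Num.sqrt (dotp (b i) (b i)) * Num.sqrt (dotp (b j) (b j))) ->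
  alternate i j m z = alternate j i m z.
Proof.
move=> m2 hC; set th : R := pi / m%:R.
have m0 : (m%:R : R) != 0 by rewrite pnatr_eq0; lia.
have mth : m%:R * th = pi by rewrite /th mulrC divfK.
have mgt : (1 : R) < m%:R by rewrite ltr1n.
have sth : 0 < sin th.
  apply: sin_gt0_pi; rewrite /th divr_gt0 ?pi_gt0 ?ltr0n //=; last lia.
  rewrite ltr_pdivrMr ?ltr_pMr ?pi_gt0 // (lt_trans _ mgt) //.
have hC' : dotp (b j) (b i) = - cos th *
    (Num.sqrt (dotp (b j) (b j)) * Num.sqrt (dotp (b i) (b i))).
  by rewrite dotpC hC (mulrC (Num.sqrt (dotp (b i) _))).
have [e1 e2] := alternate_coord (th := th) hC m z.
have [f1 f2] := alternate_coord (th := th) hC' m z.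
move: e1 e2 f1 f2; rewrite mth !(sinD pi) sinpi cospi !sinN => e1 e2 f1 f2.
have div l (x y : E) : sin th * (beta l x / Num.sqrt (dotp (b l) (b l))) =
    sin th * (beta l y / Num.sqrt (dotp (b l) (b l))) -> beta l x = beta l y.
  move/(mulfI (lt0r_neq0 sth))/(divIf _); apply.
  by rewrite lt0r_neq0 // norm_gt0.
have [bi bj] : beta i (alternate i j m z) = beta i (alternate j i m z) /\
               beta j (alternate i j m z) = beta j (alternate j i m z).
  move: e1 e2 f1 f2; case: (odd m) => e1 e2 f1 f2; split; apply: div;
   rewrite ?e1 ?e2 ?f1 ?f2; ring.
have [u [u' E1]] := alternate_span i j m z; have [w [w' E2]] := alternate_span j i m z.
apply/eqP; rewrite -subr_eq0 -dotp_eq0; set e := _ - _.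
have eE : e = (u - w') *: b i + (u' - w) *: b j.
  rewrite /e E1 E2 opprD addrACA subrr add0r !scalerBl opprD.
  by rewrite (addrC (- (w *: _))) addrACA.
have ei : dotp (b i) e = 0 by rewrite -(@bary_diff _ _ b c) bi subrr.
have ej : dotp (b j) e = 0 by rewrite -(@bary_diff _ _ b c) bj subrr.
by rewrite {1}eE dotpDl !dotpZl ei ej !mulr0 addr0.
Qed.

(** * Termination and confluence of folding, and the fundamental domain *)

Hypothesis dih : forall i j, i != j -> exists m : nat, (2 <= m)%N /\
  dotp (b i) (b j) = - cos (pi / m%:R) *
    (Num.sqrt (dotp (b i) (b i)) * Num.sqrt (dotp (b j) (b j))).
Hypothesis proper : acts_properly s.

Inductive folds : E -> E -> Prop :=
| folds_refl z : folds z z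
| folds_step i z z' : beta i z < 0 -> folds (s i z) z' -> folds z z'.

Lemma folds_trans x y z : folds x y -> folds y z -> folds x z.
Proof. by elim=> // i x' y' h _ IH /IH; apply: folds_step. Qed.

Lemma folds_snoc i x y : folds x y -> beta i y < 0 -> folds x (s i y).
Proof.
by move=> h h'; apply: (folds_trans h); apply: (folds_step h'); exact: folds_refl.
Qed.

(** The angles in [alternate_coord] stay in [[0, pi]], so the coordinate at the next wall stays
    negative and each further letter is a folding step. *)
Lemma folds_alternate i j m k z : (2 <= m)%N ->
  dotp (b i) (b j) = - cos (pi / m%:R) *
    (Num.sqrt (dotp (b i) (b i)) * Num.sqrt (dotp (b j) (b j))) ->
  beta i z < 0 -> beta j z < 0 -> (k < m)%N ->
  folds (s i z) (alternate i j k.+1 z).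
Proof.
move=> m2 hC zi zj; elim: k => [|k IH] km; first exact: folds_refl.
rewrite [alternate i j k.+2 z]/=; apply: folds_snoc; first by apply: IH; lia.
set th : R := pi / m%:R.
have [h _] := alternate_coord (th := th) hC k.+1 z; move: h.
set l := if odd k.+1 then j else i; set y := alternate _ _ _ _ => h.
have m0 : 0 < (m%:R : R) by rewrite ltr0n; lia.
have piE : pi = m%:R * th by rewrite /th mulrC divfK // lt0r_neq0.
have th0 : 0 < th by rewrite divr_gt0 // pi_gt0.
have le_sin r : (r <= m)%N -> 0 <= sin (r%:R * th).
  move=> rm; apply: sin_ge0_pi; rewrite mulr_ge0 ?ler0n ?(ltW th0) //=.
  by rewrite piE ler_pM2r // ler_nat.
have lt_sin r : (0 < r < m)%N -> 0 < sin (r%:R * th).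
  case/andP=> r0 rm; apply: sin_gt0_pi; rewrite mulr_gt0 ?ltr0n //=.
  by rewrite piE ltr_pM2r // ltr_nat.
have sth : 0 < sin th by have := lt_sin 1%N; rewrite mul1r; apply; lia.
have e1 : k.+1%:R * th + th = k.+2%:R * th by rewrite -[in RHS]natr1 mulrDl mul1r.
(* This sine is zero when [k + 2 = m]; strictness comes from [s2]. *)
have s1 : 0 <= sin (k.+2%:R * th) by apply: le_sin.
have s2 : 0 < sin (k.+1%:R * th) by apply: lt_sin.
have neg r x : beta r x < 0 -> beta r x / Num.sqrt (dotp (b r) (b r)) < 0.
  by move=> ?; rewrite pmulr_llt0 // invr_gt0 norm_gt0.
have : sin th * (beta l y / Num.sqrt (dotp (b l) (b l))) < 0.
  rewrite h e1 -oppr_gt0 opprD ltr_wpDl //.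
    by rewrite -mulrN mulr_ge0 // oppr_ge0 ltW // neg.
  by rewrite -mulrN mulr_gt0 // oppr_gt0 neg.
by rewrite pmulr_rlt0 // pmulr_llt0 // invr_gt0 norm_gt0.
Qed.

(** The common target is the image of [z] under the alternating word of length [m], which by the
    braid relation may start with either letter. *)
Lemma folds_local_confluence i j z : beta i z < 0 -> beta j z < 0 ->
  exists u, folds (s i z) u /\ folds (s j z) u.
Proof.
move=> zi zj; have [<-|ij] := eqVneq i j; first by exists (s i z); split; exact: folds_refl.
have [m [m2 hC]] := dih ij.
have hC' : dotp (b j) (b i) = - cos (pi / m%:R) *
    (Num.sqrt (dotp (b j) (b j)) * Num.sqrt (dotp (b i) (b i))).
  by rewrite dotpC hC (mulrC (Num.sqrt (dotp (b i) _))).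
have mE : m = m.-1.+1 by lia.
exists (alternate i j m z); split; first by rewrite mE; apply: folds_alternate hC _ _ _ => //; lia.
by rewrite (alternate_braid z m2 hC) mE; apply: folds_alternate hC' _ _ _ => //; lia.
Qed.

Lemma interior_point : exists x, forall i, 0 < beta i x.
Proof.
have l1 : \sum_(j < n.+1) (n.+1%:R^-1 : R) = 1.
  by rewrite sumr_const card_ord -[LHS]mulr_natl mulfV // pnatr_eq0.
exists (\sum_j n.+1%:R^-1 *: v j) => i.
by rewrite (bary_comb hb (l := fun=> n.+1%:R^-1)) // invr_gt0 ltr0n.
Qed.

(** The squared distance drops by [- 4 * beta i z * beta i x0 / dotp (b i) (b i)]. *)
Lemma refl_closer i x0 z : 0 < beta i x0 -> beta i z < 0 ->
  dotp (s i z - x0) (s i z - x0) < dotp (z - x0) (z - x0).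
Proof.
move=> h0 hz; have b0 : 0 < dotp (b i) (b i) by rewrite dotp_gt0 (bary_grad_neq0 hb).
rewrite refl_mapE addrAC; set k := _ / _.
rewrite (dotpBB (z - x0)) !dotpZr dotpZl (dotpC _ (b i)) -(@bary_diff _ _ b c) -subr_gt0.
have -> : forall D, D - (D - 2 * (k * (beta i z - beta i x0)) +
    k * (k * dotp (b i) (b i))) = - 4 * beta i z * beta i x0 / dotp (b i) (b i).
  by move=> D; rewrite /k; field; rewrite lt0r_neq0.
by rewrite divr_gt0 // mulr_gt0 // nmulr_lgt0 //; lra.
Qed.

(** Noetherian induction for folding: each step approaches a fixed interior point, and properness
    leaves finitely many orbit points in the ball concerned. *)
Lemma fold_ind (P : E -> Prop) :
  (forall z, (forall i, beta i z < 0 -> P (s i z)) -> P z) -> forall z, P z.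
Proof.
move=> H z; have [x0 hx0] := interior_point.
pose d (y : E) := dotp (y - x0) (y - x0).
pose G := [set g | Wgrp s g /\ exists y, d y <= d z /\ d (g y) <= d z].
have /finite_seqP [l lE] : finite_set [set g z | g in G].
  exact/finite_image/proper.
pose S y := (exists2 g, Wgrp s g & y = g z) /\ d y <= d z.
have Sl y : S y -> y \in l.
  move=> [[g Wg yE] yz]; have : [set g z | g in G] y.
    by exists g => //; split=> //; exists z; rewrite -yE.
  by rewrite lE.
have Ss y i : S y -> beta i y < 0 -> S (s i y).
  move=> [[g Wg ->] yz] hi; split; last first.
    by apply: le_trans yz; rewrite ltW // refl_closer.
  by exists (s i \o g) => //; apply: gen_comp Wg; exact: W_gen.
(* The measure is the number of listed orbit points strictly closer to [x0] than [y]. *)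
have key k : forall y, S y -> (count (fun q => (d q < d y)%R) l < k)%N -> P y.
  elim: k => // k IH y Sy hk; apply: H => i hi; have Si := Ss y i Sy hi.
  apply: IH => //; rewrite -ltnS; apply: leq_ltn_trans hk; apply: (@count_lt _ _ _ _ (s i y)).
  - by move=> q /= /lt_trans; apply; exact: refl_closer.
  - exact: Sl.
  - exact: refl_closer.
  - by rewrite ltxx.
apply: (key (count (fun q => (d q < d z)%R) l).+1) => //; split=> //.
by exists id => //; exact: gen_id.
Qed.

Definition in_chamber z := forall i, 0 <= beta i z.

Lemma folds_exists z : exists2 y, folds z y & in_chamber y.
Proof.
elim/fold_ind: z => z IH.
have [h|/existsNP [i /negP]] := pselect (in_chamber z); first by exists z => //; exact: folds_refl.
by rewrite -ltNge => hi; have [y h1 h2] := IH i hi; exists y => //; exact: folds_step h1.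
Qed.

(** Newman's argument: termination and local confluence give unique normal forms. *)
Lemma folds_unique z y y' : folds z y -> folds z y' -> in_chamber y -> in_chamber y' -> y = y'.
Proof.
elim/fold_ind: z y y' => z IH y y' hy hy' cy cy'.
have nochamber i (q : E) : in_chamber q -> ~ beta i q < 0.
  by move=> /(_ i); rewrite leNgt => /negP.
case: hy IH hy' cy => {z y} [z|i z y hi hy] IH hy' cy.
  by case: hy' IH cy cy' => // j z1 z' hj _ _ cy1 _; case: (nochamber j _ cy1 hj).
case: hy' IH hi hy cy' => {z y'} [z|j z y' hj hy'] IH hi hy cy'.
  by case: (nochamber i _ cy' hi).
have [u [iu ju]] := folds_local_confluence hi hj.
have [q uq cq] := folds_exists u.
rewrite (IH i hi y q) //; last exact: folds_trans uq.
by apply: (IH j hj) => //; exact: folds_trans uq.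
Qed.

(** For a single generator, the sign of the coordinate decides: [s i] is a fold of [x], or it folds
    [s i x] back to [x], or it fixes [x]. *)
Lemma folds_invariant g z y : Wgrp s g -> folds z y -> in_chamber y -> folds (g z) y.
Proof.
elim=> // f h [i ->] _ IH zy cy; move: (IH zy cy) => {IH zy} /=; move: (h z) => x xy.
have [hi|hi|hi] := ltgtP (beta i x) 0.
- have [y' h1 h2] := folds_exists (s i x).
  by rewrite (folds_unique xy (folds_step hi h1)).
- apply: (@folds_step i); last by rewrite refl_mapK // (bary_grad_neq0 hb).
  by rewrite aff_refl_self ?oppr_lt0 // (bary_grad_neq0 hb).
- by have -> : s i x = x by apply/Fix_refl => //; exact: (bary_grad_neq0 hb).
Qed.

(** Normal forms are constant on orbits, and a point of the chamber is its own normal form. *)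
Lemma chamber_orbit g x : Wgrp s g -> in_chamber x -> in_chamber (g x) -> g x = x.
Proof.
move=> Wg cx cgx; apply: (@folds_unique (g x)) => //; first exact: folds_refl.
by apply: folds_invariant => //; exact: folds_refl.
Qed.

(* A reflection whose mirror met the interior of the simplex would exchange two
   of its interior points. *)
Lemma refl_sign a k : a != 0 -> Wgrp s (refl_map a k) ->
  (forall j, 0 <= aff a k (v j)) \/ (forall j, aff a k (v j) <= 0).
Proof.
move=> a0 Wr; apply: contrapT => /not_orP [/existsNP [j1 /negP h1] /existsNP [j2 /negP h2]].
move: h1 h2; rewrite -!ltNge => h1 h2.
have [x0 hx0] := interior_point; set m := aff a k x0.
have [j hj mj] : exists2 j, aff a k (v j) != 0 & m * aff a k (v j) <= 0.
  have [m0|m0] := leP 0 m.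
    by exists j1; [exact: ltr0_neq0 | rewrite mulr_ge0_le0 // ltW].
  by exists j2; [exact: lt0r_neq0 | rewrite mulr_le0_ge0 // ltW].
(* The segment from [x0] to [v j] meets the mirror at parameter [m / (m - q)], which is below one
   because [q] is nonzero; so the meeting point is interior. *)
have [x hx fx] : exists2 x, (forall i, 0 < beta i x) & aff a k x = 0.
  set q := aff a k (v j) in hj mj.
  have mq : m - q != 0.
    apply: contraNneq hj => /eqP; rewrite subr_eq0 => /eqP mq.
    by move: mj; rewrite mq -expr2 => h; rewrite -sqrf_eq0 eq_le h sqr_ge0.
  set t := m / (m - q).
  have t0 : 0 <= t.
    have -> : t = m * (m - q) / (m - q) ^+ 2 by rewrite /t; field.
    by rewrite divr_ge0 ?sqr_ge0 // mulrBr subr_ge0 (le_trans mj) // -expr2 sqr_ge0.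
  have t1 : 0 < 1 - t.
    have -> : 1 - t = (q ^+ 2 - m * q) / (m - q) ^+ 2 by rewrite /t; field.
    rewrite divr_gt0 // ?lt_def ?sqr_ge0 ?sqrf_eq0 ?mq //.
    have q2 : 0 < q ^+ 2 by rewrite lt_def sqr_ge0 sqrf_eq0 hj.
    by rewrite subr_ge0 subr_eq0 (le_trans mj) ?ltW // andbT gt_eqF // (le_lt_trans mj).
  exists (x0 + t *: (v j - x0)) => [i|]; last first.
    rewrite aff_line dotpBr; have -> : dotp a (v j) - dotp a x0 = q - m by rewrite /q /m /aff; ring.
    by rewrite -/m /t; field.
  rewrite aff_line -(@bary_diff _ _ b c) (bary_vert hb).
  have -> : beta i x0 + t * ((i == j)%:R - beta i x0) =
      (1 - t) * beta i x0 + t * (i == j)%:R by ring.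
  by rewrite ltr_pwDl ?mulr_gt0 // mulr_ge0 // ler0n.
(* Both [x + e *: a] and [x - e *: a] stay in the chamber, and the reflection exchanges them. *)
have [e e0 he] := small_step (fun i => dotp (b i) a) hx.
have rE : refl_map a k (x + e *: a) = x + (- e) *: a.
  rewrite refl_mapE aff_line fx add0r -addrA -scalerBl; congr (_ + _ *: _).
  by have := dotp_eq0 a; rewrite (negPf a0) => /negbT h; field.
have c1 : in_chamber (x + e *: a).
  move=> i; rewrite aff_line; have := he i; have := ler_norm (- dotp (b i) a).
  rewrite normrN => h1' h2'; have : e * - dotp (b i) a <= beta i x.
    by apply: le_trans h2'; rewrite ler_pM2l.
  by rewrite mulrN; lra.
have c2 : in_chamber (x + (- e) *: a).
  move=> i; rewrite aff_line; have := he i; have := ler_norm (dotp (b i) a).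
  move=> h1' h2'; have : e * dotp (b i) a <= beta i x.
    by apply: le_trans h2'; rewrite ler_pM2l.
  by rewrite mulNr; lra.
have := chamber_orbit Wr c1; rewrite rE => /(_ c2) /addrI /eqP.
rewrite -subr_eq0 -scalerBl scaler_eq0 (negPf a0) orbF.
by move=> /eqP; lra.
Qed.

End Fold.

(** * Words in the facet reflections and fixed points *)

Section Products.
Set Implicit Arguments.
Unset Strict Implicit.
Variables (R : realType) (n : nat).
Local Notation E := 'rV[R]_n.

Lemma compl_cat (T : Type) (l1 l2 : seq (T -> T)) : compl (l1 ++ l2) = compl l1 \o compl l2.
Proof. by elim: l1 => //= f l1 ->. Qed.

Definition rp (p : E * R) : E -> E := refl_map p.1 p.2.

Lemma compl_translate (L : seq (E * R)) x e :
  (forall p, p \in L -> dotp p.1 e = 0) -> compl (map rp L) (x + e) = compl (map rp L) x + e.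
Proof.
elim: L => //= p L IH h; rewrite IH => [|q qL]; last by apply: h; rewrite inE qL orbT.
rewrite /rp !refl_mapE affD h ?mem_head // addr0 -!addrA; congr (_ + _).
by rewrite addrC.
Qed.

Lemma compl_dotp (L : seq (E * R)) x e :
  (forall p, p \in L -> dotp e p.1 = 0) -> dotp e (compl (map rp L) x) = dotp e x.
Proof.
elim: L => //= p L IH h; rewrite /rp refl_mapE dotpBr dotpZr h ?mem_head // mulr0 subr0.
by apply: IH => q qL; apply: h; rewrite inE qL orbT.
Qed.

Lemma compl_inj (L : seq (E * R)) : (forall p, p \in L -> p.1 != 0) -> injective (compl (map rp L)).
Proof.
elim: L => [|p L IH] /= h x y //; rewrite /rp => /(congr1 (refl_map p.1 p.2)).
rewrite !refl_mapK ?h ?mem_head // => /IH; apply => q qL.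
by apply: h; rewrite inE qL orbT.
Qed.

(** Linear independence in triangular form: a dual vector only has to kill the later normals, which
    suits peeling letters off the left end. *)
Fixpoint indep (L : seq E) : Prop :=
  if L is a :: L' then
    (exists2 e, dotp e a != 0 & forall a', a' \in L' -> dotp e a' = 0) /\ indep L'
  else True.

(** The letters after the first do not change the pairing with the dual vector [e], so the first
    letter cannot move the point. *)
Lemma compl_fix_each (L : seq (E * R)) x : indep (map fst L) ->
  compl (map rp L) x = x -> forall p, p \in L -> rp p x = x.
Proof.
elim: L => //= q L IH [[e e1 e2] iL] fx.
have q0 : q.1 != 0 by apply: contraNneq e1 => ->; rewrite dotp0r.
have h : compl (map rp L) x = rp q x by rewrite -[in RHS]fx /rp refl_mapK.
have fq : rp q x = x.
  have : dotp e (compl (map rp L) x) = dotp e x.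
    by apply: compl_dotp => p pL; apply: e2; apply: map_f.
  rewrite h /rp refl_mapE dotpBr dotpZr => /eqP; rewrite subr_eq addrC -subr_eq subrr eq_sym.
  by rewrite mulf_eq0 (negPf e1) orbF => /eqP ->; rewrite scale0r subr0.
move=> p; rewrite inE => /orP[/eqP -> //|]; apply: IH => //.
by rewrite h.
Qed.

Lemma indep_dual (L : seq E) (e : nat -> E) :
  (forall i j, (i < size L)%N -> (j < size L)%N -> dotp (e i) (nth 0 L j) = (i == j)%:R) ->
  indep L.
Proof.
elim: L e => //= a L IH e h; split.
  exists (e 0%N); first by rewrite (h 0%N 0%N) // oner_eq0.
  move=> a' /(nthP 0) [j jL <-]; exact: (h 0%N j.+1).
by apply: (IH (e \o S)) => i j iL jL; apply: (h i.+1 j.+1).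
Qed.

(** A nonzero vector orthogonal to all normals would translate the fixed point to another one. Hence
    the normals span, and if there are [n] of them they are independent. *)
Lemma compl_unique_fix (L : seq (E * R)) y :
  (forall x, compl (map rp L) x = x <-> x = y) ->
  (n <= size L)%N /\ (size L = n -> forall p, p \in L -> rp p y = y).
Proof.
move=> uniq_y; have fy : compl (map rp L) y = y by apply/uniq_y.
pose M : 'M[R]_(size L, n) := \matrix_(i < size L) (nth (0, 0) L i).1.
have dM (e : E) (i : 'I_(size L)) : (e *m M^T) 0 i = dotp e (nth (0, 0) L i).1.
  by rewrite dotpE mxE; apply: eq_bigr => j _; rewrite !mxE.
have rkM : (n <= \rank M)%N.
  rewrite leqNgt; apply/negP => rk; have : kermx M^T != 0.
    by rewrite -mxrank_eq0 mxrank_ker mxrank_tr subn_eq0 -ltnNge.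
  move/rowV0Pn => [e /sub_kermxP eM e0].
  have : y + e = y.
    apply/uniq_y; rewrite compl_translate ?fy // => p /(nthP (0, 0)) [i iL <-].
    by rewrite dotpC -(dM e (Ordinal iL)) eM mxE.
  by move/eqP; rewrite -subr_eq0 addrAC subrr add0r (negPf e0).
split; first exact: leq_trans rkM (rank_leq_row M).
move=> sL; apply: compl_fix_each fy.
(* The columns of a right inverse are dual to the rows of [M]. *)
have [N NM] : exists N : 'M[R]_(n, size L), M *m N = 1%:M.
  apply/row_freeP; rewrite /row_free eqn_leq rank_leq_row.
  by apply: leq_trans rkM; rewrite sL.
pose e k : E := if insub k is Some i then (col i N)^T else 0.
apply: (@indep_dual _ e) => i j; rewrite size_map => iL jL.
rewrite /e insubT (nth_map (0, 0)) // dotpC.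
have := congr1 (fun X : 'M[R]_(size L) => X (Ordinal jL) (Ordinal iL)) NM; rewrite /= !mxE.
rewrite -val_eqE /= eq_sym => <-; rewrite dotpE; apply: eq_bigr => k _.
by rewrite !mxE.
Qed.

End Products.

(** * The exchange property and words with one letter missing *)

Section Chamber.
Set Implicit Arguments.
Unset Strict Implicit.
Variables (R : realType) (n : nat).
Local Notation E := 'rV[R]_n.
Variables (v b : 'I_n.+1 -> E) (c : 'I_n.+1 -> R).
Hypotheses (n0 : (0 < n)%N) (hb : bary v b c).
Local Notation beta i := (aff (b i) (c i)).
Local Notation r := (fun i => refl_map (b i) (c i)).
Local Notation word o := (compl [seq refl_map (b i) (c i) | i <- o]).
Hypothesis sign : forall a k, a != 0 -> Wgrp r (refl_map a k) ->
  (forall j, 0 <= aff a k (v j)) \/ (forall j, aff a k (v j) <= 0).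
Hypothesis proper : acts_properly r.

Let b0 i : b i != 0 := bary_grad_neq0 hb i n0.

Lemma W_word o : Wgrp r (word o).
Proof.
elim: o => [|i o IH] /=; first exact: gen_id.
by apply: gen_comp IH; exact: W_gen.
Qed.

Lemma W_conj g g' f : Wgrp r g -> Wgrp r g' -> Wgrp r f -> Wgrp r (g \o f \o g').
Proof. by move=> Wg Wg' Wf; apply: gen_comp Wg'; apply: gen_comp Wf. Qed.

(** Pull the form back through the first letter [r i]. If it stays nonnegative on the chamber,
    continue with the rest of the word. Otherwise it is nonpositive there, so the original form
    vanishes at all vertices but [v i] and the reflection is [r i] itself. *)
Lemma word_deletion o a k : a != 0 -> Wgrp r (refl_map a k) ->
  (forall j, 0 <= aff a k (v j)) -> (exists j, aff a k (word o (v j)) < 0) ->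
  exists o1 i o2, o = o1 ++ i :: o2 /\ refl_map a k \o word o = word (o1 ++ o2).
Proof.
elim: o a k => [|i o IH] a k a0 Wt pos [j neg] /=.
  by move: neg; rewrite /= ltNge pos.
have ri : rigid (r i) by exact: rigid_refl.
have rK : cancel (r i) (r i) by move=> x; exact: refl_mapK.
have [a' [k' [tE a'0 fE]]] := refl_conj a k ri rK.
have Wt' : Wgrp r (refl_map a' k').
  by rewrite -tE; apply: W_conj => //; exact: W_gen.
have [pos'|neg'] := sign (a'0 a0) Wt'.
  have [|o1 [l [ o2 [-> e]]]] := IH _ _ (a'0 a0) Wt' pos'.
    by exists j; rewrite -fE.
  exists (i :: o1), l, o2; split=> //=; rewrite -e -tE.
  by apply/funext => x /=; rewrite rK.
exists [::], i, o; split=> //=.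
have -> : refl_map a k = r i; last by apply/funext => x /=; rewrite rK.
apply/(bary_facet_refl hb i _ n0); split; first by exists a, k.
move=> l li; apply/Fix_refl => //; apply/eqP; rewrite eq_le pos andbT.
have rvl : r i (v l) = v l.
  by apply/Fix_refl => //; rewrite (bary_vert hb) eq_sym (negPf li).
by have := neg' l; rewrite -fE rvl.
Qed.

(** The gradients other than [b k] are independent, so a fixed point lies on every wall but the
    [k]-th. *)
Lemma word_fix o k x : uniq o -> (forall i, (i \in o) = (i != k)) ->
  word o x = x <-> x = v k.
Proof.
move=> uo mo; split=> [fx|->]; last first.
  have : all [pred i | i != k] o by apply/allP => i; rewrite mo.
  elim: o {uo mo} => //= i o IH /andP[ik /IH ->].
  by apply/Fix_refl => //; rewrite (bary_vert hb) (negPf ik).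
pose L := [seq (b i, c i) | i <- o].
have LE : map (@rp R n) L = [seq r i | i <- o] by rewrite -map_comp.
have iL : indep (map fst L).
  have : all [pred i | i != k] o by apply/allP => i; rewrite mo.
  rewrite /L; elim: o uo {mo fx L LE} => //= i o IH /andP[io uo] /andP[ik ko].
  split; last exact: IH.
  (* Pairing with this vector gives one on [b i] and zero on the gradients of the later letters. *)
  exists (v i - v k).
    rewrite dotpC -(@bary_diff _ _ b c) !(bary_vert hb) eqxx (negPf ik) subr0 oner_eq0 //.
  move=> a' /mapP [p /mapP [j jo ->] ->] /=.
  rewrite dotpC -(@bary_diff _ _ b c) !(bary_vert hb).
  rewrite (negPf (allP ko j jo)) subr0; case: eqP => // ji.
  by rewrite -ji jo in io.
have fo i : i != k -> beta i x = 0.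
  rewrite -mo => io; apply/Fix_refl => //.
  by apply: (compl_fix_each iL _ (p := (b i, c i))); rewrite ?LE //; apply: map_f.
have fk : beta k x = 1.
  by rewrite -(bary_sum1 hb x) (bigD1 k) //= [X in _ = _ + X]big1 ?addr0.
apply: (bary_inj hb) => i; rewrite (bary_vert hb).
by case: (eqVneq i k) => [->|/fo].
Qed.

Definition okp (p : E * R) := p.1 != 0 /\ Wgrp r (rp p).

Lemma okp_conj g g' (L : seq (E * R)) : Wgrp r g -> Wgrp r g' -> cancel g' g -> cancel g g' ->
  (forall p, p \in L -> okp p) ->
  exists L', [/\ size L' = size L, forall p, p \in L' -> okp p &
    compl (map (@rp R n) L') = g \o compl (map (@rp R n) L) \o g'].
Proof.
move=> Wg Wg' g'K gK; elim: L => [|p L IH] ok /=.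
  by exists [::]; split=> //; apply/funext => x /=; rewrite g'K.
have [|L' [sL okL eL]] := IH; first by move=> q qL; apply: ok; rewrite inE qL orbT.
have [p0 Wp] := ok p (mem_head _ _).
have [a' [k' [tE a'0 _]]] := refl_conj p.1 p.2 (W_rigid n0 hb Wg') g'K.
exists ((a', k') :: L'); split=> /=; first by rewrite sL.
  move=> q; rewrite inE => /orP[/eqP ->|]; last exact: okL.
  by split; [exact: a'0 | rewrite /rp /= -tE; exact: W_conj].
by rewrite eL /rp /= -tE; apply/funext => x /=; rewrite gK.
Qed.

Lemma reflection_okp t : reflection_of r t -> exists2 p, okp p & t = rp p.
Proof. by move=> [Wt [a [k [a0 tE]]]]; exists (a, k); rewrite /okp /rp /= -?tE. Qed.

Lemma factorization_okp w l : refl_factorization r w l <->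
  exists2 L, forall p, p \in L -> okp p & l = map (@rp R n) L /\ compl l = w.
Proof.
split=> [[h wE]|[L ok [-> wE]]]; last first.
  split=> // l1 f l2 lE; have : nth id (map (@rp R n) L) (size l1) = f.
    by rewrite lE nth_cat ltnn subnn.
  have sL : (size l1 < size L)%N.
    by rewrite -(size_map (@rp R n)) lE size_cat /= addnS ltnS leq_addr.
  rewrite (nth_map (0, 0)) // => <-; have [p0 Wp] := ok _ (mem_nth (0, 0) sL).
  by split=> //; eexists; eexists; split; first exact: p0.
suff [L ok lE] : exists2 L, forall p, p \in L -> okp p & l = map (@rp R n) L by exists L.
elim: l h {wE} => [|f l IH] h; first by exists [::].
have [|L ok ->] := IH; first by move=> l1 g l2 lE; apply: (h (f :: l1) g l2); rewrite lE.
have [|p okp ->] := @reflection_okp f; first exact: (h [::] f l).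
by exists (p :: L) => // q; rewrite inE => /orP[/eqP ->|/ok].
Qed.

Lemma aff_comb_ge0 a k g x : rigid g -> (forall i, 0 <= beta i x) ->
  (forall i, 0 <= aff a k (g (v i))) -> 0 <= aff a k (g x).
Proof.
move=> rg hx h; rewrite (bary_recover hb x) rigid_comb ?(bary_sum1 hb) //.
rewrite aff_comb ?(bary_sum1 hb) //; apply: sumr_ge0 => i _; exact: mulr_ge0.
Qed.

(** * Vertical reflections and minimal factorizations *)

Section Axis.
Variables (o : seq 'I_n.+1) (w' : E -> E) (x0 d : E).
Hypothesis po : perm_eq o (enum 'I_n.+1).
Local Notation w := (word o).
Hypotheses (Ww' : Wgrp r w') (wK : cancel w w') (w'K : cancel w' w).
Hypothesis x0_in : forall i, 0 <= beta i x0.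
Hypothesis w_axis : forall k, w (x0 + k *: d) = x0 + (k + 2) *: d.
Hypothesis d0 : d != 0.

(** The orbit of the chamber vertices under powers of [w]; [axial_vertexP] identifies it with the
    axial vertices. *)
Inductive on_axis : E -> Prop :=
| on_axis_vert i : on_axis (v i)
| on_axis_w y : on_axis y -> on_axis (w y)
| on_axis_w' y : on_axis y -> on_axis (w' y).

Lemma uniq_o : uniq o.
Proof. by rewrite (perm_uniq po) enum_uniq. Qed.

Lemma mem_o i : i \in o.
Proof. by rewrite (perm_mem po) mem_enum. Qed.

Lemma size_o : size o = n.+1.
Proof. by rewrite (perm_size po) size_enum_ord. Qed.

Lemma remove_o o1 k o2 : o = o1 ++ k :: o2 ->
  uniq (o1 ++ o2) /\ (forall i, (i \in o1 ++ o2) = (i != k)).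
Proof.
move=> oE; have p : perm_eq o (k :: o1 ++ o2) by rewrite oE perm_catC /= perm_cons perm_catC.
have := uniq_o; rewrite (perm_uniq p) => /andP[ko uo]; split=> // i.
have := mem_o i; rewrite (perm_mem p) inE.
by case: eqVneq => [-> _|_ /= ->] //; exact: negPf.
Qed.

(** In use [h] is a power of [w]. Moved back by [h], the crossing happens at the chamber itself,
    where a letter can be deleted; [h] then carries the vertex fixed by the shorter word to the
    fixed point sought. *)
Lemma crossing_fix a k h h' : a != 0 -> Wgrp r (refl_map a k) ->
  Wgrp r h -> Wgrp r h' -> cancel h h' -> cancel h' h -> (forall x, h (w x) = w (h x)) ->
  (forall i, on_axis (h (v i))) ->
  (forall j, 0 <= aff a k (h (v j))) -> (exists j, aff a k (h (w (v j))) < 0) ->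
  exists2 y, on_axis y & forall x, refl_map a k (w x) = x <-> x = y.
Proof.
move=> a0 Wt Wh Wh' hK h'K hw hax pos [j neg].
have [a' [k' [tE a'0 fE]]] := refl_conj a k (W_rigid n0 hb Wh) hK.
have Wt' : Wgrp r (refl_map a' k') by rewrite -tE; exact: W_conj.
have [||o1 [i [ o2 [oE e]]]] := @word_deletion o a' k' (a'0 a0) Wt'.
- by move=> l; rewrite -fE.
- by exists j; rewrite -fE.
have [uo mo] := remove_o oE.
exists (h (v i)) => // x.
have xE : x = h (h' x) by rewrite h'K.
have key : refl_map a k (w x) = h (word (o1 ++ o2) (h' x)).
  by rewrite -e -tE /= h'K hw h'K.
rewrite key; split=> [hx|->]; last by rewrite hK; congr h; apply/word_fix.
by rewrite xE; congr h; apply/(word_fix _ uo mo); rewrite -[RHS](congr1 h' hx) hK.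
Qed.

Lemma W_iter g m : Wgrp r g -> Wgrp r (iter m g).
Proof.
move=> Wg; elim: m => [|m IH]; first exact: gen_id.
by have := gen_comp Wg IH.
Qed.

Lemma iterK (g g' : E -> E) m : cancel g g' -> cancel (iter m g) (iter m g').
Proof. by move=> gK; elim: m => // m IH x; rewrite iterSr iterS gK. Qed.

Lemma iter_w m : iter m w x0 = x0 + (m%:R * 2) *: d.
Proof.
elim: m => [|m IH]; first by rewrite mul0r scale0r addr0.
by rewrite iterS IH w_axis -[m.+1%:R]natr1 mulrDl mul1r.
Qed.

Lemma iter_w' m : iter m w' x0 = x0 - (m%:R * 2) *: d.
Proof.
elim: m => [|m IH]; first by rewrite mul0r scale0r subr0.
apply: (can_inj wK); rewrite iterS w'K IH -[- ((m%:R * 2) *: d)]scaleNr.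
rewrite -[- ((m.+1%:R * 2) *: d)]scaleNr w_axis.
by congr (_ + _ *: _); rewrite -[m.+1%:R]natr1; ring.
Qed.

Lemma large_nat (x y : R) : y < 0 -> exists m : nat, x + (m%:R * 2) * y < 0.
Proof.
move=> y0; pose m := Num.bound `|x / - y|.
have ny : 0 < - y by rewrite oppr_gt0.
exists m; have : x / - y < m%:R by apply: le_lt_trans (archi_boundP (normr_ge0 _)); exact: ler_norm.
rewrite ltr_pdivrMr // => h.
have : 0 <= m%:R * - y by rewrite mulr_ge0 // ltW.
by move: h; rewrite mulrN -mulrA (mulrC 2) mulrA; lra.
Qed.

(** Nonzero slope along [d] forces a sign change among the translates of the chamber by powers of
    [w]; the first one is the crossing. *)
Lemma vertical_fix a k : a != 0 -> Wgrp r (refl_map a k) -> dotp a d != 0 ->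
  exists2 y, on_axis y & forall x, refl_map a k (w x) = x <-> x = y.
Proof.
have Ww := W_word o.
wlog : a k / dotp a d < 0 => [wl a0 Wt ad|ad a0 Wt _].
  have [lt|gt|/eqP] := ltgtP (dotp a d) 0; [exact: wl | | by rewrite (negPf ad)].
  rewrite -(refl_mapN a k); apply: wl; rewrite ?refl_mapN ?oppr_eq0 ?dotpNl ?oppr_lt0 //.
  by rewrite oppr_eq0.
have [pos|neg] := sign a0 Wt.
  have : exists m, `[< exists j, aff a k (iter m w (v j)) < 0 >].
    have [m hm] := large_nat (aff a k x0) ad; exists m; apply/asboolP.
    apply: contrapT => /forallNP h; have : 0 <= aff a k (iter m w x0).
      apply: aff_comb_ge0 => //; first exact: (W_rigid n0 hb (W_iter m Ww)).
      by move=> i; rewrite leNgt; apply/negP.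
    by rewrite iter_w aff_line leNgt hm.
  (* By minimality the crossing lies between the translates by [iter m w] and [iter m.+1 w]. *)
  case/ex_minnP => -[|m] /asboolP [j hj] mmin; first by move: hj; rewrite /= ltNge pos.
  have mpos l : 0 <= aff a k (iter m w (v l)).
    rewrite leNgt; apply/negP => hl; have := mmin m; rewrite ltnn => /implyP.
    by rewrite implybF => /asboolPn; apply; exists l.
  apply: (crossing_fix a0 Wt (W_iter m Ww) (W_iter m Ww')) => //.
  - exact: iterK.
  - exact: iterK.
  - by move=> x; rewrite -iterSr iterS.
  - by move=> i {mmin mpos hj}; elim: m => [|m IH]; [exact: on_axis_vert | exact: on_axis_w].
  - by exists j; rewrite -iterSr.
(* The form is nonpositive on the chamber and decreases along [d], so the change is sought
   backwards. *)
have : exists m, `[< exists j, 0 < aff a k (iter m w' (v j)) >].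
  have ad' : dotp (- a) (- d) < 0 by rewrite dotpNl dotpNr opprK.
  have [m hm] := large_nat (- aff a k x0) ad; exists m; apply/asboolP.
  apply: contrapT => /forallNP h; have : 0 <= aff (- a) (- k) (iter m w' x0).
    apply: aff_comb_ge0 => //; first exact: (W_rigid n0 hb (W_iter m Ww')).
    by move=> i; rewrite affN oppr_ge0 leNgt; apply/negP.
  by rewrite affN iter_w' -scaleNr aff_line leNgt mulNr opprB addrC hm.
case/ex_minnP => -[|m] /asboolP [j hj] mmin; first by move: hj; rewrite /= ltNge neg.
have mneg l : aff a k (iter m w' (v l)) <= 0.
  rewrite leNgt; apply/negP => hl; have := mmin m; rewrite ltnn => /implyP.
  by rewrite implybF => /asboolPn; apply; exists l.
have Wm1 := W_iter m.+1 Ww'; have Wm := W_iter m Ww'.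
have w'w x : iter m.+1 w' (w x) = iter m w' x by rewrite iterSr wK.
apply: (crossing_fix a0 Wt Wm1 (W_iter m.+1 Ww)).
- exact: iterK.
- exact: iterK.
- by move=> x; rewrite w'w iterS w'K.
- move=> i; elim: {mmin hj mneg Wm1 Wm w'w} m.+1 => [|l IH]; first exact: on_axis_vert.
  exact: on_axis_w'.
(* One positive vertex and the sign property make the form nonnegative on this whole translate. *)
- have [a' [k' [tE a'0 fE]]] := refl_conj a k (W_rigid n0 hb Wm1) (iterK m.+1 w'K).
  have [|p|q] := sign (a'0 a0) (k := k'); first by rewrite -tE; apply: W_conj => //; exact: W_iter.
    by move=> l; rewrite fE.
  by have := q j; rewrite -fE leNgt hj.
(* A form vanishing at all vertices of a translate has zero gradient, so some value is strictly
   negative. *)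
- apply: contrapT => /forallNP h.
  have [a' [k' [_ a'0 fE]]] := refl_conj a k (W_rigid n0 hb Wm) (iterK m w'K).
  have : a' = 0; last by move/eqP; rewrite (negPf (a'0 a0)).
  apply: (bary_aff0 (k := k') hb) => i; rewrite -fE; apply/eqP; rewrite eq_le mneg /=.
  by rewrite leNgt; apply/negP; have := h i; rewrite w'w.
Qed.

(** Letters with normals orthogonal to [d] preserve the pairing with [d], whereas [w] moves [x0] by
    [2 *: d]. *)
Lemma exists_vertical L : (forall p, p \in L -> okp p) -> compl (map (@rp R n) L) = w ->
  exists2 p, p \in L & dotp p.1 d != 0.
Proof.
move=> ok wE; apply: contrapT => h.
have : dotp d (compl (map (@rp R n) L) x0) = dotp d x0.
  apply: compl_dotp => p pL; rewrite dotpC; apply/eqP; apply: contrapT => /negP pd.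
  by apply: h; exists p.
rewrite wE -[x0 in w x0]addr0 -(scale0r d) w_axis add0r dotpDr dotpZr => /eqP.
rewrite -subr_eq0 addrAC subrr add0r mulf_eq0 pnatr_eq0 /= dotp_eq0 (negPf d0) //.
Qed.

(* A linear map fixing d is not a product in which exactly one reflection moves d. *)
Lemma exists_other_vertical L1 p L2 : (forall q, q \in L1 ++ p :: L2 -> okp q) ->
  compl (map (@rp R n) (L1 ++ p :: L2)) = w ->
  exists2 q, q \in L1 ++ L2 & dotp q.1 d != 0.
Proof.
move=> ok wE; apply: contrapT => h.
have h1 q : q \in L1 ++ L2 -> dotp q.1 d = 0.
  by move=> qL; apply/eqP; apply: contrapT => /negP qd; apply: h; exists q.
have [q qL qd] := exists_vertical ok wE.
have {qL} qE : q = p.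
  move: qL; rewrite mem_cat inE orbCA => /orP[/eqP //|]; rewrite -mem_cat => /h1 /eqP.
  by rewrite (negPf qd).
rewrite {q}qE in qd.
have p0 : p.1 != 0 by case: (ok p); rewrite // mem_cat mem_head orbT.
have e : w (x0 + d) = w x0 + d.
  have := w_axis 1; have := w_axis 0; rewrite scale1r scale0r addr0 => -> ->.
  have -> : (1 + 2 : R) = (0 + 2) + 1 by ring.
  by rewrite [in LHS]scalerDl scale1r addrA.
move: e; rewrite -wE map_cat compl_cat /= => e.
have tr1 x : compl (map (@rp R n) L1) (x + d) = compl (map (@rp R n) L1) x + d.
  by apply: compl_translate => q qL; apply: h1; rewrite mem_cat qL.
have tr2 x : compl (map (@rp R n) L2) (x + d) = compl (map (@rp R n) L2) x + d.
  by apply: compl_translate => q qL; apply: h1; rewrite mem_cat qL orbT.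
have inj1 : injective (compl (map (@rp R n) L1)).
  by apply: compl_inj => q qL; case: (ok q); rewrite // mem_cat qL.
move: e; rewrite -tr1 tr2 => /inj1; rewrite /rp !refl_mapE affD.
move: (compl _ _) => y; move: (aff _ _ _) => f.
rewrite -!addrA => /addrI; rewrite (addrC _ d) => /addrI /oppr_inj /eqP.
rewrite -subr_eq0 -scalerBl scaler_eq0 (negPf p0) orbF -mulrBl mulf_eq0 invr_eq0 dotp_eq0.
by rewrite (negPf p0) orbF -mulrBr addrAC subrr add0r mulf_eq0 pnatr_eq0 (negPf qd).
Qed.

(** As [q A q B] is [(q A q) B], letters left of [q] are conjugated and those right of it stay. *)
Lemma delete_left A q B : (forall p, p \in A ++ q :: B -> okp p) ->
  compl (map (@rp R n) (A ++ q :: B)) = w ->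
  exists2 A', size A' = size A & compl (map (@rp R n) (A' ++ B)) = rp q \o w.
Proof.
move=> ok wE; have [q0 Wq] : okp q by apply: ok; rewrite mem_cat mem_head orbT.
have qK : cancel (rp q) (rp q) by move=> x; exact: refl_mapK.
have [|A' [sA _ eA]] := okp_conj Wq Wq qK qK (L := A).
  by move=> p pA; apply: ok; rewrite mem_cat pA.
by exists A' => //; rewrite -wE !map_cat !compl_cat eA.
Qed.

Lemma delete_right A q B : (forall p, p \in A ++ q :: B -> okp p) ->
  compl (map (@rp R n) (A ++ q :: B)) = w ->
  exists2 B', size B' = size B & compl (map (@rp R n) (A ++ B')) = w \o rp q.
Proof.
move=> ok wE; have [q0 Wq] : okp q by apply: ok; rewrite mem_cat mem_head orbT.
have qK : cancel (rp q) (rp q) by move=> x; exact: refl_mapK.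
have [|B' [sB _ eB]] := okp_conj Wq Wq qK qK (L := B).
  by move=> p pB; apply: ok; rewrite mem_cat inE pB !orbT.
by exists B' => //; rewrite -wE !map_cat !compl_cat eB.
Qed.

(** Deleting a vertical letter leaves a product with a single fixed point, hence at least [n]
    letters. *)
Lemma factorization_size L : (forall p, p \in L -> okp p) ->
  compl (map (@rp R n) L) = w -> (n.+1 <= size L)%N.
Proof.
move=> ok wE; have [q qL qd] := exists_vertical ok wE.
have [q0 Wq] := ok q qL; have [y _ fy] := vertical_fix q0 Wq qd.
case/splitPr: qL ok wE => A B ok wE; have [A' sA eA] := delete_left ok wE.
have [|h _] := @compl_unique_fix _ _ (A' ++ B) y; first by move=> x; rewrite eA; exact: fy.
by move: h; rewrite !size_cat /= sA addnS.
Qed.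

(** The vertical letter [q] is moved out on the side away from [p], so [p] survives unconjugated
    among [n] letters whose product has one fixed point. *)
Lemma factor_fixes_axial L1 p L2 : (forall q, q \in L1 ++ p :: L2 -> okp q) ->
  compl (map (@rp R n) (L1 ++ p :: L2)) = w -> size (L1 ++ p :: L2) = n.+1 ->
  exists2 y, on_axis y & rp p y = y.
Proof.
move=> ok wE sL; have [q qL qd] := exists_other_vertical ok wE.
have [q0 Wq] : okp q.
  by apply: ok; move: qL; rewrite !mem_cat inE => /orP[] ->; rewrite ?orbT.
have [y ay fy] := vertical_fix q0 Wq qd.
have qK : cancel (rp q) (rp q) by move=> x; exact: refl_mapK.
move: qL; rewrite mem_cat => /orP[] qL; case/splitPr: qL ok wE sL => A B.
  rewrite -catA /= => ok wE sL; have [A' sA eA] := delete_left ok wE.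
  have [|_ h] := @compl_unique_fix _ _ (A' ++ B ++ p :: L2) y.
    by move=> x; rewrite eA; exact: fy.
  exists y => //; apply: h; last by rewrite !mem_cat mem_head !orbT.
  by apply: succn_inj; rewrite -sL (size_cat A') (size_cat A) sA /= addnS.
rewrite -cat_cons catA => ok wE sL; have [B' sB eB] := delete_right ok wE.
(* The product [w q] fixes only [q y], and this is [w y] because [q w y = y]. *)
have ty : rp q y = w y.
  by have /fy h : y = y by []; rewrite -{1}h -/(rp q _) qK.
have [|_ h] := @compl_unique_fix _ _ ((L1 ++ p :: A) ++ B') (w y).
  move=> x; rewrite eB -ty /=; split=> [h|->]; last by rewrite qK -ty.
  by rewrite -[x]qK; congr (rp q _); apply/fy; rewrite -/(rp q _) h.
exists (w y); first exact: on_axis_w.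
apply: h; last by rewrite !mem_cat mem_head !orbT.
by apply: succn_inj; rewrite -sL (size_cat _ B') (size_cat _ (q :: B)) sB /= addnS.
Qed.

(** Properness with radius zero makes the stabilizer of [x] finite, so two powers of [g]
    coincide. *)
Lemma finite_order g x : Wgrp r g -> g x = x -> exists2 N, (0 < N)%N & iter N g = id.
Proof.
move=> Wg gx; have gxi m : iter m g x = x by elim: m => //= m ->.
have [g' [Wg' gK g'K]] := W_inv n0 hb Wg.
have fin := proper x 0.
have : ~ injective (fun m => iter m g).
  move=> inj; apply: infinite_nat.
  have := @finite_preimage _ _ _ (fun m => iter m g) _ fin.
  move=> /(_ (fun m1 m2 _ _ => @inj m1 m2)); apply: sub_finite_set => m _.
  split; first exact: W_iter.
  by exists x; rewrite gxi subrr dotp0l.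
have wl m1 m2 : (m1 < m2)%N -> iter m1 g = iter m2 g -> iter (m2 - m1) g = id.
  move=> lt e; apply/funext => y; apply: (can_inj (iterK m1 gK)).
  by rewrite -iterD subnKC ?(ltnW lt) // e.
move=> ninj; apply: contrapT => h; apply: ninj => m1 m2 /= e.
have [lt|lt|//] := ltngtP m1 m2; exfalso; apply: h.
  by exists (m2 - m1)%N; [rewrite subn_gt0 | exact: wl].
by exists (m1 - m2)%N; [rewrite subn_gt0 | exact: wl].
Qed.

(* The sum of the form over the orbit is g-invariant and vanishes at the only fixed
   point of g, hence everywhere. *)
Lemma orbit_sign_change g x a k : Wgrp r g -> (forall y, g y = y <-> y = x) ->
  a != 0 -> aff a k x = 0 -> exists m j, aff a k (iter m g (v j)) < 0.
Proof.
move=> Wg fx a0 ax; have gx : g x = x by apply/fx.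
apply: contrapT => h.
have pos m j : 0 <= aff a k (iter m g (v j)).
  by rewrite leNgt; apply/negP => hm; apply: h; exists m, j.
have [N N0 gN] := finite_order Wg gx.
have [g' [Wg' gK g'K]] := W_inv n0 hb Wg.
have : exists ak : nat -> E * R, forall m y, aff a k (iter m g y) = aff (ak m).1 (ak m).2 y.
  have /choice [ak hak] : forall m : nat, exists p : E * R, forall y,
      aff a k (iter m g y) = aff p.1 p.2 y.
    move=> m; have [a' [k' [_ _ e]]] := refl_conj a k (W_rigid n0 hb (W_iter m Wg)) (iterK m gK).
    by exists (a', k').
  by exists ak.
case=> ak hak; pose A := \sum_(m < N) (ak m).1; pose K := \sum_(m < N) (ak m).2.
have FE y : aff A K y = \sum_(m < N) aff a k (iter m g y).
  by rewrite {1}/aff /A /K dotp_suml -sumrB; apply: eq_bigr => m _; rewrite hak.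
(* Since [iter N g = id], the summands are only shifted cyclically. *)
have Fg y : aff A K (g y) = aff A K y.
  rewrite !FE; case: N N0 gN {A K FE} => // N _ gN.
  rewrite big_ord_recr [RHS]big_ord_recl /= addrC; congr (_ + _).
    by rewrite -iterSr gN.
  by apply: eq_bigr => m _; rewrite -iterSr.
have Fx : aff A K x = 0.
  by rewrite FE big1 // => m _; suff -> : iter m g x = x by []; elim: (m : nat) => //= l ->.
(* The vector [g (x + A) - x] has the length of [A] and pairs with [A] to [dotp A A], so it equals
   [A]. Thus [x + A] is fixed too, and uniqueness gives [A = 0]. *)
have A0 : A = 0.
  have : x + A = x.
    apply/fx; apply/eqP; rewrite -subr_eq0 -dotp_eq0.
    have e1 := Fg (x + A); have e2 := rigid_dist (x + A) x (W_rigid n0 hb Wg).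
    rewrite gx addrAC subrr add0r in e2.
    have e3 : dotp A (g (x + A) - x) = dotp A A.
      by move: e1 Fx; rewrite /aff dotpBr dotpDr; lra.
    by rewrite opprD addrA dotpBB e2 (dotpC _ A) e3; apply/eqP; ring.
  by move/eqP; rewrite -subr_eq0 addrAC subrr add0r => /eqP.
have K0 : K = 0 by move: Fx; rewrite A0 /aff dotp0l sub0r => /eqP; rewrite oppr_eq0 => /eqP.
have : a = 0; last by move/eqP; rewrite (negPf a0).
apply: (bary_aff0 (k := k) hb) => i.
have : \sum_(m < N) aff a k (iter m g (v i)) = 0 by rewrite -FE A0 K0 /aff dotp0l subr0.
move/eqP; rewrite psumr_eq0 => [/allP hi|m _]; last exact: pos.
by have /= /eqP := hi (Ordinal N0) (mem_index_enum _).
Qed.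

(** Here [w = q g] with [g] the word lacking the letter [i]. The sign change along the orbits of [g]
    splits the given reflection off [g], leaving [n - 1] letters. *)
Lemma vertex_factor a k i : a != 0 -> Wgrp r (refl_map a k) -> refl_map a k (v i) = v i ->
  exists L, [/\ forall q, q \in L -> okp q, size ((a, k) :: L) = n &
    exists2 q, okp q & compl (map (@rp R n) (q :: (a, k) :: L)) = w].
Proof.
wlog pos : a k / forall j, 0 <= aff a k (v j) => [wl a0 Wt tv|].
  have [pos|neg] := sign a0 Wt; first exact: wl.
  have [||||L [ok sL [q oq wE]]] := wl (- a) (- k); rewrite ?oppr_eq0 ?refl_mapN //.
    by move=> j; rewrite affN oppr_ge0.
  by exists L; split=> //; exists q => //; rewrite -wE /= /rp /= refl_mapN.
move=> a0 Wt /(Fix_refl _ _ a0) tv.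
have [ o1 [ o2 oE]] : exists o1 o2, o = o1 ++ i :: o2.
  by case/splitPr: (mem_o i) => o1 o2; exists o1, o2.
have [uo mo] := remove_o oE.
set g := word (o1 ++ o2).
have Wg : Wgrp r g by exact: W_word.
have fg y : g y = y <-> y = v i by exact: word_fix.
have [g' [Wg' gK g'K]] := W_inv n0 hb Wg.
have : exists m, `[< exists j, aff a k (iter m g (v j)) < 0 >].
  by have [m hm] := orbit_sign_change Wg fg a0 tv; exists m; apply/asboolP.
case/ex_minnP => -[|m] /asboolP [j hj] mmin; first by move: hj; rewrite /= ltNge pos.
have mpos l : 0 <= aff a k (iter m g (v l)).
  rewrite leNgt; apply/negP => hl; have := mmin m; rewrite ltnn => /implyP.
  by rewrite implybF => /asboolPn; apply; exists l.
have Wm := W_iter m Wg; have Wm' := W_iter m Wg'.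
have mK := iterK m gK; have m'K := iterK m g'K.
(* Pulled back by [iter m g], the sign change lies between the chamber and its image under [g]. *)
have [a' [k' [tE a'0 fE]]] := refl_conj a k (W_rigid n0 hb Wm) mK.
have Wt' : Wgrp r (refl_map a' k') by rewrite -tE; exact: W_conj.
have [||o3 [l [ o4 [oE' e]]]] := @word_deletion (o1 ++ o2) a' k' (a'0 a0) Wt'.
- by move=> l; rewrite -fE.
- by exists j; rewrite -fE -/g -iterSr.
pose L0 := [seq (b i, c i) | i <- o3 ++ o4].
have ok0 p : p \in L0 -> okp p.
  by move=> /mapP [l' _ ->]; split; [exact: b0 | exact: W_gen].
have L0E : compl (map (@rp R n) L0) = word (o3 ++ o4) by rewrite -map_comp.
have [L [sL okL eL]] := okp_conj Wm Wm' m'K mK ok0.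
(* Conjugating the letter [i] by the prefix [o1] brings it in front of [g]. *)
have [A' [WA' AK A'K]] := W_inv n0 hb (W_word o1).
have rK : cancel (r i) (r i) by move=> x; exact: refl_mapK.
have [a2 [k2 [t2E a20 _]]] := refl_conj (b i) (c i) (W_rigid n0 hb WA') A'K.
have gE : g = refl_map a k \o compl (map (@rp R n) L).
  rewrite eL L0E -e -tE; apply/funext => x /=.
  rewrite m'K refl_mapK // -/g -iterSr iterS m'K.
  by [].
exists L; split=> //.
  have := congr1 size oE; have := congr1 size oE'.
  rewrite size_o /= sL size_map !size_cat /=; lia.
exists (a2, k2).
  by split; [exact: a20 | rewrite /rp /= -t2E; apply: W_conj => //; [exact: W_word | exact: W_gen]].
rewrite /= -[rp (a, k) \o _]gE /rp /= -t2E /g oE !map_cat !compl_cat /=.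
by apply/funext => x /=; rewrite AK.
Qed.

Definition in_factorization t := exists L1 p L2,
  [/\ forall q, q \in L1 ++ p :: L2 -> okp q,
      compl (map (@rp R n) (L1 ++ p :: L2)) = w, size (L1 ++ p :: L2) = n.+1
    & rp p = t].

Lemma in_factorization_conj g g' t : Wgrp r g -> Wgrp r g' -> cancel g' g -> cancel g g' ->
  (forall x, g (w (g' x)) = w x) -> in_factorization t -> in_factorization (g \o t \o g').
Proof.
move=> Wg Wg' g'K gK gw [L1 [p [L2 [ok wE sL <-]]]].
have [|L1' [s1 ok1 e1]] := okp_conj Wg Wg' g'K gK (L := L1).
  by move=> q qL; apply: ok; rewrite mem_cat qL.
have [|L2' [s2 ok2 e2]] := okp_conj Wg Wg' g'K gK (L := L2).
  by move=> q qL; apply: ok; rewrite mem_cat inE qL !orbT.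
have [|L0 [s0 ok0 e0]] := okp_conj Wg Wg' g'K gK (L := [:: p]).
  by move=> q; rewrite inE => /eqP ->; apply: ok; rewrite mem_cat mem_head orbT.
case: L0 s0 ok0 e0 => [|p' [|? ?]] //= _ okp' ep.
exists L1', p', L2'; split.
- move=> q; rewrite mem_cat inE => /or3P[/ok1 //|/eqP ->|/ok2 //].
  by apply: okp'; rewrite mem_head.
- apply/funext => x; rewrite -[RHS]gw -wE !map_cat !compl_cat /= e1 e2.
  by rewrite -[rp p' \o id]/(rp p') in ep; rewrite ep /= !gK.
- by rewrite -sL !size_cat /= s1 s2.
- exact: ep.
Qed.

(** Conjugation by powers of [w] permutes the factorizations of [w], so [y] may be moved to a vertex
    of the chamber. *)
Lemma axial_factor y a k : on_axis y -> a != 0 -> Wgrp r (refl_map a k) -> refl_map a k y = y ->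
  in_factorization (refl_map a k).
Proof.
have Ww := W_word o.
move=> ay; elim: ay a k => {y} [i|y ay IH|y ay IH] a k a0 Wt ty.
- have [L [ok sL [q oq wE]]] := vertex_factor a0 Wt ty.
  exists [:: q], (a, k), L; split=> //=; last exact: (congr1 S sL).
  by move=> q'; rewrite !inE => /or3P[/eqP -> //|/eqP -> //|]; exact: ok.
- have [a' [k' [tE a'0 _]]] := refl_conj a k (W_rigid n0 hb Ww) wK.
  have -> : refl_map a k = w \o refl_map a' k' \o w'.
    by apply/funext => x; rewrite -tE /= !w'K.
  apply: in_factorization_conj => //; first by move=> x; rewrite w'K.
  apply: IH (a'0 a0) _ _; first by rewrite -tE; exact: W_conj.
  by rewrite -tE /= ty wK.
- have [a' [k' [tE a'0 _]]] := refl_conj a k (W_rigid n0 hb Ww') w'K.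
  have -> : refl_map a k = w' \o refl_map a' k' \o w.
    by apply/funext => x; rewrite -tE /= !wK.
  apply: in_factorization_conj => //.
  apply: IH (a'0 a0) _ _; first by rewrite -tE; exact: W_conj.
  by rewrite -tE /= ty w'K.
Qed.

End Axis.
End Chamber.

(** * The axis of a bipartite Coxeter element *)

Section Bipartite.
Set Implicit Arguments.
Unset Strict Implicit.
Variables (R : realType) (n : nat).
Local Notation E := 'rV[R]_n.
Variables (v b : 'I_n.+1 -> E) (c : 'I_n.+1 -> R).
Hypotheses (n0 : (0 < n)%N) (hb : bary v b c).
Local Notation beta i := (aff (b i) (c i)).
Local Notation r := (fun i => refl_map (b i) (c i)).
Local Notation word o := (compl [seq refl_map (b i) (c i) | i <- o]).
Variable (cl : 'I_n.+1 -> bool).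
Hypothesis orth : forall i j, i != j -> cl i = cl j -> dotp (b i) (b j) = 0.

Let b0 i : b i != 0 := bary_grad_neq0 hb i n0.
Let bb0 i : dotp (b i) (b i) != 0.
Proof. by rewrite dotp_eq0. Qed.

(** Orthogonal reflections leave each other's forms unchanged, so their displacements add. *)
Lemma ortho_word L x : uniq L -> {in L &, forall i j, cl i = cl j} ->
  word L x = x - \sum_(i <- L) (2 * beta i x / dotp (b i) (b i)) *: b i.
Proof.
elim: L => [|i L IH] /=; first by rewrite big_nil subr0.
move=> /andP[iL uL] hcl; rewrite IH // => [|j k jL kL]; last first.
  by apply: hcl; rewrite inE ?jL ?kL orbT.
rewrite refl_mapE big_cons; set S := \sum_(j <- L) _.
have -> : beta i (x - S) = beta i x.
  rewrite affD dotpNr /S dotp_sumr big_seq big1 ?subr0 ?addr0 ?oppr0 ?addr0 // => j jL.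
  rewrite dotpZr (@orth i j) ?mulr0 //; first by apply/eqP => ij; rewrite ij jL in iL.
  by apply: hcl; rewrite inE ?eqxx ?jL ?orbT.
by rewrite opprD addrA addrAC.
Qed.

Local Notation wp j := (wpart r cl j).

Lemma wpartE j x : wp j x = x - \sum_(i | cl i == j) (2 * beta i x / dotp (b i) (b i)) *: b i.
Proof.
rewrite /wpart ortho_word; [|exact: filter_uniq (enum_uniq _)|].
  by rewrite big_filter big_enum_cond.
by move=> i k; rewrite !mem_filter => /andP[/eqP -> _] /andP[/eqP -> _].
Qed.

Lemma dotp_class_sum i j (F : 'I_n.+1 -> R) : cl i = j ->
  dotp (b i) (\sum_(k | cl k == j) F k *: b k) = F i * dotp (b i) (b i).
Proof.
move=> ci; rewrite dotp_sumr (bigD1 i) ?ci //= dotpZr big1 ?addr0 // => k /andP[/eqP ck ki].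
by rewrite dotpZr orth ?mulr0 ?ck // eq_sym.
Qed.

Lemma aff_wpart i j x : cl i = j -> beta i (wp j x) = - beta i x.
Proof.
move=> ci; rewrite wpartE affD dotpNr (dotp_class_sum _ ci) divfK //.
by rewrite mulr2n mulrDl mul1r opprD addrA subrr sub0r.
Qed.

Lemma wpartK j : involutive (wp j).
Proof.
move=> x; rewrite [LHS]wpartE (eq_bigr (fun i => - ((2 * beta i x / dotp (b i) (b i)) *: b i))).
  by rewrite sumrN opprK wpartE subrK.
by move=> i /eqP ci; rewrite (aff_wpart _ ci) mulrN mulNr scaleNr.
Qed.

Lemma W_wpart j : Wgrp r (wp j).
Proof. exact: W_word. Qed.

(** The gradient of a form that is 0 on [flat false] and 1 on [flat true]: the direction of their
    common perpendicular. *)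
Definition axis_dir : E := \sum_(i | cl i == false) b i.
Local Notation D := axis_dir.

Lemma axis_dir_true : D = - \sum_(i | cl i == true) b i.
Proof.
have := bary_sum_grad hb; rewrite (bigID (fun i => cl i == false)) /= => /eqP.
rewrite addr_eq0 => /eqP; rewrite -/axis_dir => ->; congr (- _).
by apply: eq_bigl => i; case: (cl i).
Qed.

(** Write [D] as a signed sum over the class of [i]; all other terms are then orthogonal to
    [b i]. *)
Lemma dotp_axis_dir i : dotp (b i) D = (if cl i then - 1 else 1) * dotp (b i) (b i).
Proof.
case ci: (cl i).
  rewrite axis_dir_true dotpNr -(eq_bigr _ (fun k _ => scale1r (b k))).
  by rewrite (dotp_class_sum (fun=> 1) ci) mul1r mulN1r.
rewrite /axis_dir -(eq_bigr _ (fun k _ => scale1r (b k))).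
by rewrite (dotp_class_sum (fun=> 1) ci).
Qed.

Lemma axis_dir_neq0 : D != 0.
Proof.
apply/eqP => D0; have := dotp_axis_dir ord0; rewrite D0 dotp0r => /esym/eqP.
by rewrite mulf_eq0 (negPf (bb0 _)) orbF; case: (cl ord0); rewrite ?oppr_eq0 oner_eq0.
Qed.

Local Notation lam := (dotp D D)^-1.

Lemma lam_gt0 : 0 < lam.
Proof. by rewrite invr_gt0 dotp_gt0 axis_dir_neq0. Qed.

Definition flat j : set E := [set x | forall i, cl i = j -> beta i x = 0].

Lemma aff_hull_face j :
  aff_hull (simplex v `&` [set x | forall i, cl i = j -> Fix (r i) x]) = flat j.
Proof.
apply/seteqP; split=> x.
  move=> [k [p [l [hp [l1 ->]]]]] i ci; rewrite aff_comb // big1 // => m _.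
  have [_ /(_ i ci) /Fix_refl -> //] := hp m; exact: mulr0.
move=> hx; have [i0 ci0] : exists i0, cl i0 != j.
  apply: contrapT => h; have := bary_sum1 hb x; rewrite big1 => [/esym/eqP|i _].
    by rewrite oner_eq0.
  by apply: hx; apply/eqP; apply: contrapT => /negP ci; apply: h; exists i.
have inF i : cl i != j -> (simplex v `&` [set x | forall i, cl i = j -> Fix (r i) x]) (v i).
  move=> ci; split; first by apply/(simplexP hb) => k; rewrite (bary_vert hb) ler0n.
  move=> k ck; apply/Fix_refl => //; rewrite (bary_vert hb).
  by case: eqP => // ki; rewrite -ki ck eqxx in ci.
(* Vertices of class [j] lie off the face but have weight zero, so [v i0] stands in for them. *)
exists n.+1, (fun i => v (if cl i == j then i0 else i)), (fun i => beta i x); split.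
  by move=> i; case: ifP => [_|/negbT]; apply: inF.
split; first exact: (bary_sum1 hb).
rewrite {1}(bary_recover hb x); apply: eq_bigr => i _.
by case: eqP => [/hx ->|//]; rewrite !scale0r.
Qed.

Lemma flat_dist x0 x1 : flat false x0 -> flat true x1 -> dotp (x1 - x0) D = 1.
Proof.
move=> h0 h1; rewrite /axis_dir dotp_sumr -(bary_sum1 hb x1).
rewrite [RHS](bigID (fun i => cl i == false)) /= [X in _ = _ + X]big1 ?addr0; last first.
  by move=> i; case ci: (cl i) => // _; exact: h1.
by apply: eq_bigr => i /eqP ci; rewrite dotpC -(@bary_diff _ _ b c) h0 // subr0.
Qed.

(** Pythagoras: [x1 - x0] always pairs to 1 with [D], so the excess over [lam] is the squared
    deviation from [lam *: D]. *)
Lemma flat_dist_ge x0 x1 : flat false x0 -> flat true x1 ->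
  dotp (x0 - x1) (x0 - x1) = dotp (x1 - x0 - lam *: D) (x1 - x0 - lam *: D) + lam.
Proof.
move=> h0 h1; have := flat_dist h0 h1.
rewrite -[x0 - x1]opprB dotpNl dotpNr opprK (dotpBB (x1 - x0)) !dotpZr !dotpZl => ->.
by have := axis_dir_neq0; rewrite -dotp_eq0 => D0; field.
Qed.

(** Moving by [lam *: D] lowers each coordinate of class [true] by exactly its weight here, so the
    move ends on [flat true]. *)
Definition axis_point : E := \sum_i (if cl i then lam * dotp (b i) (b i) else 0) *: v i.

Lemma axis_point_sum : \sum_i (if cl i then lam * dotp (b i) (b i) else 0) = 1.
Proof.
rewrite -big_mkcond /= -mulr_sumr.
have -> : \sum_(i | cl i) dotp (b i) (b i) = dotp D D.
  rewrite {1}axis_dir_true dotpNl dotp_suml -sumrN.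
  apply: eq_big => [i|i ci]; first by case: (cl i).
  by rewrite dotp_axis_dir ci; ring.
by rewrite mulVf // dotp_eq0 axis_dir_neq0.
Qed.

Lemma flat_axis_point : flat false axis_point.
Proof. by move=> i ci; rewrite (bary_comb hb) ?axis_point_sum // ci. Qed.

Lemma flat_axis_point' : flat true (axis_point + lam *: D).
Proof.
move=> i ci; rewrite aff_line (bary_comb hb) ?axis_point_sum // dotp_axis_dir ci; ring.
Qed.

Section Axis.
Variables (x0 x1 : E).
Hypotheses (x0f : flat false x0) (x1f : flat true x1).
Local Notation d := (x1 - x0).
Hypothesis x1E : d = lam *: D.

Lemma axis_in0 i : 0 <= beta i x0.
Proof.
case ci: (cl i); last by rewrite x0f.
have := bary_diff b c i x1 x0; rewrite x1f // x1E dotpZr dotp_axis_dir ci sub0r mulN1r mulrN.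
by move/oppr_inj ->; rewrite mulr_ge0 ?dotp_ge0 // ltW // lam_gt0.
Qed.

Lemma axis_in1 i : 0 <= beta i x1.
Proof.
case ci: (cl i); first by rewrite x1f.
have := bary_diff b c i x1 x0; rewrite x0f // x1E dotpZr dotp_axis_dir ci subr0 mul1r.
by move=> ->; rewrite mulr_ge0 ?dotp_ge0 // ltW // lam_gt0.
Qed.

(** On the axis the coordinate [i] of class [false] is [k * lam * dotp (b i) (b i)], so the
    displacements add up to a multiple of [D]. *)
Lemma wpart0_axis k : wp false (x0 + k *: d) = x0 - k *: d.
Proof.
rewrite wpartE (eq_bigr (fun i => (2 * k * lam) *: b i)); last first.
  move=> i /eqP ci; rewrite aff_line x0f // add0r x1E dotpZr dotp_axis_dir ci.
  by congr (_ *: _); field; rewrite bb0 dotp_eq0 axis_dir_neq0.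
rewrite -scaler_sumr -/D -[2 * k * lam]mulrA -!scalerA -x1E scaler_nat mulr2n opprD addrA.
by rewrite addrK.
Qed.

Lemma wpart1_axis k : wp true (x0 + k *: d) = x0 + (2 - k) *: d.
Proof.
have e : x0 + k *: d = x1 + (k - 1) *: d.
  by rewrite scalerBl scale1r opprB addrA addrC addrA subrK addrC.
rewrite e wpartE (eq_bigr (fun i => (2 * (k - 1) * lam) *: - b i)); last first.
  move=> i /eqP ci; rewrite aff_line x1f // add0r x1E dotpZr dotp_axis_dir ci scalerN -scaleNr.
  by congr (_ *: _); field; rewrite bb0 dotp_eq0 axis_dir_neq0.
rewrite -scaler_sumr sumrN -axis_dir_true -[2 * (k - 1) * lam]mulrA -!scalerA -x1E.
rewrite scaler_nat mulr2n opprD addrA addrK.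
set dd := d; have -> : x1 = x0 + dd by rewrite /dd addrC subrK.
rewrite -addrA -scaleNr -{1}[dd]scale1r -scalerDl; congr (_ + _ *: _); ring.
Qed.

Lemma wpart_axis k : wp true (wp false (x0 + k *: d)) = x0 + (k + 2) *: d.
Proof.
by rewrite wpart0_axis -scaleNr wpart1_axis opprK (addrC 2).
Qed.

End Axis.

Lemma flat_closest x0 x1 : flat false x0 -> flat true x1 ->
  (forall y0 y1, flat false y0 -> flat true y1 ->
     dotp (x0 - x1) (x0 - x1) <= dotp (y0 - y1) (y0 - y1)) <->
  x1 - x0 = lam *: D.
Proof.
move=> h0 h1; split=> [hmin|e y0 y1 hy0 hy1]; last first.
  rewrite (flat_dist_ge h0 h1) (flat_dist_ge hy0 hy1) e subrr dotp0l add0r lerDr; exact: dotp_ge0.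
have := hmin _ _ flat_axis_point flat_axis_point'.
rewrite (flat_dist_ge h0 h1) (flat_dist_ge flat_axis_point flat_axis_point').
rewrite [axis_point + _]addrC addrK subrr dotp0l lerD2r => h.
by apply/eqP; rewrite -subr_eq0 -dotp_eq0 eq_le h dotp_ge0.
Qed.

Local Notation oo :=
  ([seq i <- enum 'I_n.+1 | cl i == true] ++ [seq i <- enum 'I_n.+1 | cl i == false]).

Lemma perm_oo : perm_eq oo (enum 'I_n.+1).
Proof.
have -> : [seq i <- enum 'I_n.+1 | cl i == false] =
    [seq i <- enum 'I_n.+1 | predC (fun i => cl i == true) i].
  by apply: eq_filter => i /=; case: (cl i).
by rewrite perm_filterC.
Qed.

Lemma word_oo : word oo = wp true \o wp false.
Proof. by rewrite map_cat compl_cat. Qed.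

Local Notation w' := (wp false \o wp true).

Lemma word_ooK : cancel (word oo) w'.
Proof. by move=> x; rewrite word_oo /= !wpartK. Qed.

Lemma word_ooK' : cancel w' (word oo).
Proof. by move=> x; rewrite word_oo /= !wpartK. Qed.

Local Notation axial := (on_axis v b c oo w').

(** A vertex outside class [k] is fixed by [wp k]; one inside is fixed by the other factor, so
    [wp k] acts on it as [w] or its inverse. Conjugation by either factor inverts [w]. *)
Lemma on_axis_wpart j y : axial y -> axial (wp j y).
Proof.
have fixv i k : cl i != k -> wp k (v i) = v i.
  move=> ci; rewrite wpartE big1 ?subr0 // => l /eqP cll.
  rewrite (bary_vert hb); case: eqP => [li|_]; last by rewrite mulr0 mul0r scale0r.
  by rewrite -li cll eqxx in ci.
have key i k : axial (wp k (v i)).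
  have [ci|/(@fixv i) ->] := eqVneq (cl i) k; last exact: on_axis_vert.
  have e : v i = wp (~~ k) (v i) by rewrite fixv // ci; case: (k).
  rewrite e; case: k ci e => ci e.
    have -> : wp true (wp (~~ true) (v i)) = word oo (v i) by rewrite word_oo.
    exact: on_axis_w (on_axis_vert _ _ _ _ _ _).
  have -> : wp false (wp (~~ false) (v i)) = w' (v i) by [].
  exact: on_axis_w' (on_axis_vert _ _ _ _ _ _).
move=> ay; elim: ay j => {y} [i|y ay IH|y ay IH] [].
- exact: key.
- exact: key.
- by rewrite word_oo /= wpartK.
- have -> : wp false (word oo y) = w' (wp false y) by rewrite word_oo.
  exact: on_axis_w' (IH false).
- have -> : wp true (w' y) = word oo (wp true y) by rewrite word_oo.
  exact: on_axis_w (IH true).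
- by rewrite /= wpartK.
Qed.

Lemma axial_points_exist : exists (x0 x1 : E) (X : int -> E),
  [/\ flat false x0, flat true x1, x1 - x0 = lam *: D, X 0 = x0 & X 1 = x1] /\
  (forall i, X (- i) = wp false (X i)) /\ (forall i, X (2 - i) = wp true (X i)).
Proof.
pose x0 := axis_point; pose x1 := axis_point + lam *: D.
have x1E : x1 - x0 = lam *: D by rewrite /x1 /x0 addrC addKr.
exists x0, x1, (fun i : int => x0 + i%:~R *: (x1 - x0)); split; last split=> i.
- split; [exact: flat_axis_point | exact: flat_axis_point' | by [] | |].
    by rewrite mulr0z scale0r addr0.
  by rewrite mulr1z scale1r addrC subrK.
- by rewrite (wpart0_axis flat_axis_point x1E) mulrNz scaleNr.
- by rewrite (wpart1_axis flat_axis_point' x1E) rmorphB.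
Qed.

(** * Reflections in minimal factorizations and axial vertices *)

Section Reflections.
Hypothesis sign : forall a k, a != 0 -> Wgrp r (refl_map a k) ->
  (forall j, 0 <= aff a k (v j)) \/ (forall j, aff a k (v j) <= 0).
Hypothesis proper : acts_properly r.
Variables (x0 x1 : E).
Hypotheses (x0f : flat false x0) (x1f : flat true x1) (x1E : x1 - x0 = lam *: D).

Lemma R0_on_axis t : reflection_of r t ->
  R0 r (word oo) t <-> exists y, axial y /\ Fix t y.
Proof.
move=> tr; have Ww' : Wgrp r w' by apply: gen_comp; exact: W_wpart.
have d0 : x1 - x0 != 0.
  by rewrite x1E scaler_eq0 negb_or axis_dir_neq0 andbT lt0r_neq0 // lam_gt0.
have wax k : word oo (x0 + k *: (x1 - x0)) = x0 + (k + 2) *: (x1 - x0).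
  by rewrite word_oo /= wpart_axis.
have fsize := factorization_size n0 hb sign perm_oo Ww' word_ooK word_ooK'
  (axis_in0 x0f x1f x1E) wax d0.
split.
  move=> [l [l1 [l2 [[fl lmin] lE]]]].
  have [L ok [lL wE]] := (factorization_okp b c (word oo) l).1 fl.
  have sL : size L = n.+1.
    apply/eqP; rewrite eqn_leq fsize // -?lL // andbT.
    (* The word in the facet reflections bounds the minimal length above by [n + 1]. *)
    have /lmin : refl_factorization r (word oo) [seq r i | i <- oo].
      apply/factorization_okp; exists [seq (b i, c i) | i <- oo]; last by rewrite -map_comp.
      by move=> p /mapP [i _ ->]; split; [exact: b0 | exact: W_gen].
    by rewrite lL !size_map (perm_size perm_oo) size_enum_ord.
  have l1L : (size l1 < size L)%N.
    by rewrite -(size_map (@rp R n)) -lL lE size_cat /= addnS ltnS leq_addr.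
  set p := nth (0, 0) L (size l1).
  have LE : L = take (size l1) L ++ p :: drop (size l1).+1 L.
    by rewrite -drop_nth // cat_take_drop.
  have pE : rp p = t.
    by rewrite -(nth_map (0, 0) id (@rp R n)) // -lL lE nth_cat ltnn subnn.
  have := factor_fixes_axial n0 hb sign perm_oo Ww' word_ooK word_ooK'
    (axis_in0 x0f x1f x1E) wax d0 (L1 := take (size l1) L) (p := p) (L2 := drop (size l1).+1 L).
  rewrite -LE -lL pE => /(_ ok wE sL) [y ay ty]; by exists y.
case: tr => Wt [a [k [a0 tE]]] [y [ay ty]].
have [||L1 [p [L2 [ok wE sL pE]]]] :=
  axial_factor n0 hb sign proper perm_oo Ww' word_ooK word_ooK' d0 ay a0 (k := k).
- by rewrite -tE.
- by rewrite -tE.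
exists (map (@rp R n) (L1 ++ p :: L2)), (map (@rp R n) L1), (map (@rp R n) L2).
split; last by rewrite map_cat /= pE tE.
split; first by apply/factorization_okp; exists (L1 ++ p :: L2).
move=> l' /factorization_okp [L' ok' [-> wE']].
by rewrite !size_map sL; exact: fsize.
Qed.

Variable X : int -> E.
Hypotheses (X0 : X 0 = x0) (X1 : X 1 = x1).
Hypotheses (Xneg : forall i, X (- i) = wp false (X i)) (Xrev : forall i, X (2 - i) = wp true (X i)).

(** Both factors preserve the orbit [axial]. Conversely, each application of [w] shifts the index by
    two and carries [x0], [x1] to consecutive points of [X]. *)
Lemma axial_vertexP y : axial_vertex v id r cl X y <-> axial y.
Proof.
split.
  move=> [i [h [Wh [_ [_ [k ->]]]]]] /=.
  elim: Wh => [|f h' [] -> _ IH] /=; first exact: on_axis_vert.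
    exact: on_axis_wpart.
  exact: on_axis_wpart.
move=> ay; suff [i [h [Wh hi hi1 [k yE]]]] : exists (i : int) h,
    [/\ gen (fun f => f = wp false \/ f = wp true) h, X i = h x0, X (i + 1) = h x1
      & exists k, y = h (v k)].
  exists i, h; split=> //; split.
    by exists x0 => //; apply/(simplexP hb); exact: (axis_in0 x0f x1f x1E).
  split; first by exists x1 => //; apply/(simplexP hb); exact: (axis_in1 x0f x1f x1E).
  by exists k.
have g0 : gen (fun f => f = wp false \/ f = wp true) (wp false) by apply: gen1; left.
have g1 : gen (fun f => f = wp false \/ f = wp true) (wp true) by apply: gen1; right.
have up i : X (i + 2) = wp true (wp false (X i)).
  by rewrite -Xneg -Xrev opprK addrC.
have down i : X (i - 2) = wp false (wp true (X i)).
  by rewrite -Xrev -Xneg opprB.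
elim: ay => {y} [k|y _ [i [h [Wh hi hi1 [k ->]]]]|y _ [i [h [Wh hi hi1 [k ->]]]]].
- by exists 0, id; split; rewrite ?add0r //; [exact: gen_id | exists k].
- exists (i + 2), (wp true \o (wp false \o h)); split.
  + by apply: gen_comp g1 _; apply: gen_comp g0 _.
  + by rewrite up hi.
  + by rewrite addrAC up hi1.
  + by exists k; rewrite word_oo.
- exists (i - 2), (wp false \o (wp true \o h)); split.
  + by apply: gen_comp g0 _; apply: gen_comp g1 _.
  + by rewrite down hi.
  + by rewrite addrAC down hi1.
  + by exists k.
Qed.

End Reflections.
End Bipartite.

(** * The Coxeter diagram is a forest *)

Section Trigonometry.
Variable R : realType.

(** By the triple angle formula the cosine, which is positive, is a root of
    [4 x^3 - 3 x + 1 = (x + 1) (2 x - 1)^2]. *)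
Lemma cos_pi3 : cos (pi / 3%:R) = 2^-1 :> R.
Proof.
set t : R := pi / 3%:R; have pi0 := pi_gt0 R.
have t3 : t + t + t = pi by rewrite /t; field.
have c0 : 0 < cos t by apply: cos_gt0_pihalf; apply/andP; split; lra.
have : cos (t + t + t) = -1 by rewrite t3 cospi.
rewrite cosD cosD sinD; have := cos2Dsin2 t; move: (cos t) (sin t) c0 => x y x0 h1 h2.
have e : (x + 1) * (2 * x - 1) ^+ 2 = 0.
  have -> : (x + 1) * (2 * x - 1) ^+ 2 = 4 * x ^+ 3 - 3 * x + 1 by ring.
  have y2 : y ^+ 2 = 1 - x ^+ 2 by rewrite -h1; ring.
  have e2 : 4 * x ^+ 3 - 3 * x = (x * x - y * y) * x - (y * x + x * y) * y.
    have -> : (x * x - y * y) * x - (y * x + x * y) * y = x ^+ 3 - 3 * x * y ^+ 2 by ring.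
    by rewrite y2; ring.
  by rewrite e2 h2; ring.
move/eqP: e; rewrite mulf_eq0 sqrf_eq0 => /orP[] /eqP; first lra.
by move=> ?; lra.
Qed.

Lemma cos_pi_ge (m : nat) : (3 <= m)%N -> 2^-1 <= cos (pi / m%:R) :> R.
Proof.
move=> m3; rewrite -cos_pi3; have pi0 := pi_gt0 R.
have m0 : 0 < (m%:R : R) by rewrite ltr0n; lia.
have m3' : (3 : R) <= m%:R by rewrite ler_nat.
rewrite leNgt ltr_cos; last 2 first.
- rewrite in_itv /= divr_ge0 ?(ltW pi0) ?(ltW m0) //= ler_pdivrMr // ler_peMr ?(ltW pi0) //; lra.
- rewrite in_itv /= divr_ge0 ?(ltW pi0) //= ler_pdivrMr // ler_peMr ?(ltW pi0) //; lra.
by rewrite -leNgt ler_pM2l // lef_pV2 // ?posrE //; lra.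
Qed.

End Trigonometry.

(** * Cycles, leaves and heights in finite graphs *)

Section Cycles.
Set Implicit Arguments.
Unset Strict Implicit.
Variable R : realType.

Lemma ordS_neq k (a : 'I_k) : (1 < k)%N -> ordS a != a.
Proof.
move=> k1; rewrite -val_eqE /=; have := ltn_ord a; case: ltngtP k1 => // k1 _ ak.
have [e|ne] := eqVneq a.+1 k; first by rewrite e modnn; lia.
by rewrite modn_small; lia.
Qed.

Lemma ordSS_neq k (a : 'I_k) : (2 < k)%N -> ordS (ordS a) != a.
Proof.
move=> k2; rewrite -val_eqE /=; have := ltn_ord a => ak.
have [e|ne] := eqVneq a.+1 k; first by rewrite e modnn modn_small; lia.
rewrite (@modn_small a.+1); last lia.
have [e|ne'] := eqVneq a.+2 k; first by rewrite e modnn; lia.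
by rewrite modn_small; lia.
Qed.

Lemma sum_delta k (x : 'I_k) : \sum_b ((b == x)%:R : R) = 1.
Proof. by rewrite (bigD1 x) //= eqxx big1 ?addr0 // => b /negPf ->. Qed.

(* G is bounded entrywise by the Gram matrix of a cycle with all labels 3, whose row
   sums are zero. *)
Lemma cycle_gram k (G : 'I_k -> 'I_k -> R) : (2 < k)%N ->
  (forall a, G a a = 1) -> (forall a b, a != b -> G a b <= 0) ->
  (forall a b, G a b = G b a) -> (forall a, G a (ordS a) <= - 2^-1) ->
  0 <= \sum_a \sum_b G a b ->
  \sum_a \sum_b G a b = 0 /\
  forall a b, a != b -> G a b = if (b == ordS a) || (a == ordS b) then - 2^-1 else 0.
Proof.
move=> k2 G1 Gn Gs Ga Gp.
pose ref (a b : 'I_k) : R := (b == a)%:R - 2^-1 * (b == ordS a)%:R - 2^-1 * (b == ord_pred a)%:R.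
have predE (a b : 'I_k) : (b == ord_pred a) = (a == ordS b).
  by apply/eqP/eqP => ->; rewrite ?ord_predK ?ordSK.
have ref0 : \sum_a \sum_b ref a b = 0.
  apply: big1 => a _; rewrite !sumrB -!mulr_sumr !sum_delta; lra.
have Sa (a : 'I_k) : ordS a != a by exact: (ordS_neq a (ltnW k2)).
have SSa (a : 'I_k) : ordS (ordS a) != a by apply: ordSS_neq.
have refE a b : a != b -> ref a b = if (b == ordS a) || (a == ordS b) then - 2^-1 else 0.
  move=> ab; rewrite /ref predE eq_sym (negPf ab).
  case: (eqVneq b (ordS a)) => [->|_].
    by rewrite eq_sym (negPf (SSa a)) /=; lra.
  by case: (a == ordS b) => /=; lra.
have Gref a b : G a b <= ref a b.
  have [<-|ab] := eqVneq a b.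
    have e : (a == ordS a) = false by rewrite eq_sym (negPf (Sa a)).
    by rewrite G1 /ref predE eqxx e /=; lra.
  rewrite refE //; case: eqP => [->|_] /=; first exact: Ga.
  by case: eqP => [->|_] /=; [rewrite Gs; exact: Ga | exact: Gn].
(* The difference is entrywise nonnegative with total at most zero. *)
have S0 : \sum_a \sum_b (ref a b - G a b) = 0.
  have h : 0 <= \sum_a \sum_b (ref a b - G a b).
    by apply: sumr_ge0 => a _; apply: sumr_ge0 => b _; rewrite subr_ge0.
  apply/eqP; rewrite eq_le h andbT; under eq_bigr do rewrite sumrB.
  by rewrite sumrB ref0 sub0r oppr_le0.
have GE a b : G a b = ref a b.
  move/eqP: S0; rewrite psumr_eq0 => [/allP /(_ a (mem_index_enum _))|a' _]; last first.
    by apply: sumr_ge0 => b' _; rewrite subr_ge0.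
  rewrite /= psumr_eq0 => [/allP /(_ b (mem_index_enum _))|b' _]; last by rewrite subr_ge0.
  by rewrite /= subr_eq0 => /eqP.
split; last by move=> a b ab; rewrite GE refE.
by rewrite -[RHS]ref0; apply: eq_bigr => a _; apply: eq_bigr => b _.
Qed.

(** On a longest simple path inside [J], all neighbours in [J] of the first vertex lie on the path;
    one beyond the second vertex would close a cycle. *)
Lemma acyclic_leaf (I : finType) (e : rel I) (J : {set I}) : symmetric e -> irreflexive e ->
  (forall x p, uniq (x :: p) -> (1 < size p)%N -> ~~ cycle e (x :: p)) ->
  J != finset.set0 -> exists2 i, i \in J & (#|[set j in J | e i j]| <= 1)%N.
Proof.
move=> es ei nocyc /set0Pn [i0 i0J]; apply: contrapT => nl.
have deg i : i \in J -> (1 < #|[set j in J | e i j]|)%N.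
  by move=> iJ; rewrite ltnNge; apply/negP => h; apply: nl; exists i.
pose P k := `[< exists x p, [/\ path e x p, uniq (x :: p), all [in J] (x :: p) & size p = k] >].
have exP : exists k, P k by exists 0%N; apply/asboolP; exists i0, [::]; rewrite /= i0J.
have boundP k : P k -> (k <= #|I|)%N.
  move=> /asboolP [x [p [_ up _ <-]]]; apply: (@leq_trans (size (x :: p))) => //.
  by rewrite -(card_uniqP up); exact: max_card.
case: (ex_maxnP exP boundP) => k /asboolP [x [p [xp up Jp sp]]] kmax.
have xJ : x \in J by case/andP: Jp.
have nbr y : y \in J -> e x y -> y \in p.
  move=> yJ xy; apply: contraT => yp.
  have /kmax : P k.+1.
    apply/asboolP; exists y, (x :: p); split; rewrite /= ?sp //.
    - by rewrite es xy.
    - have := up; rewrite cons_uniq => /andP[-> ->]; rewrite inE negb_or yp !andbT.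
      by apply/eqP => yx; rewrite yx ei in xy.
    - by rewrite yJ.
  by rewrite ltnn.
have [y [yJ xy y0]] : exists y, [/\ y \in J, e x y & (0 < index y p)%N].
  have /card_gt1P [y [z [yS zS yz]]] := deg x xJ.
  move: yS zS; rewrite !inE => /andP[yJ xy] /andP[zJ xz].
  case: (posnP (index y p)) => [y0|]; last by exists y.
  case: (posnP (index z p)) => [z0|]; last by exists z.
  have := nth_index x (nbr y yJ xy); have := nth_index x (nbr z zJ xz).
  by rewrite y0 z0 => -> zE; rewrite zE eqxx in yz.
have yp := nbr y yJ xy.
have [p1 [p2 pE]] : exists p1 p2, p = p1 ++ y :: p2.
  by case/splitPr: yp => p1 p2; exists p1, p2.
rewrite pE in xp up y0.
have yp1 : y \notin p1 by move: up; rewrite cons_uniq cat_uniq => /and4P[_ _ /norP[]].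
have p1s : (0 < size p1)%N by move: y0; rewrite index_cat (negPf yp1) /= eqxx addn0.
rewrite -cat_rcons in xp up.
have := nocyc x (rcons p1 y); rewrite size_rcons ltnS p1s => /(_ _ isT) /negP; apply.
  by move: up; rewrite -cat_cons cat_uniq => /and3P[].
by rewrite /= rcons_path last_rcons es xy andbT; move: xp; rewrite cat_path => /andP[].
Qed.

(** Remove a leaf, take heights on the rest, and place the leaf one above or below its only
    neighbour; integers leave room below. *)
Lemma forest_height (I : finType) (e lt : rel I) : symmetric e ->
  (forall i j, e i j -> lt i j = ~~ lt j i) ->
  (forall J : {set I}, J != finset.set0 ->
     exists2 i, i \in J & (#|[set j in J | e i j]| <= 1)%N) ->
  exists h : I -> nat, forall i j, e i j -> lt i j -> h j = (h i).+1.
Proof.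
move=> es anti leaf.
have key k (J : {set I}) : #|J| = k ->
    exists h : I -> int, {in J &, forall i j, e i j -> lt i j -> h j = h i + 1}.
  elim: k J => [|k IH] J cJ.
    by exists (fun=> 0) => i j; rewrite (cards0_eq cJ) inE.
  have [|l lJ l1] := leaf J; first by rewrite -card_gt0 cJ.
  have [|h hh] := IH (J :\ l)%SET; first by move: cJ; rewrite (cardsD1 l) lJ => -[].
  have [c hc] : exists c : int, forall j, j \in (J :\ l)%SET -> e l j ->
      (lt l j -> h j = c + 1) /\ (lt j l -> c = h j + 1).
    case: (pickP [pred j in (J :\ l)%SET | e l j]) => [j0 /andP[/= j0J lj0]|none]; last first.
      by exists 0 => j jJ lj; have := none j; rewrite /= jJ lj.
    exists (if lt l j0 then h j0 - 1 else h j0 + 1) => j jJ lj.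
    have -> : j = j0.
      apply/eqP; apply: contraTT l1 => jj0; rewrite -ltnNge; apply/card_gt1P; exists j, j0.
      by move: jJ j0J; rewrite !inE => /andP[_ ->] /andP[_ ->]; rewrite lj lj0 jj0.
    by rewrite anti //; case: (lt j0 l); split=> //= _; lia.
  exists (fun i => if i == l then c else h i) => i j iJ jJ eij lij.
  have [il|il] := eqVneq i l; have [jl|jl] := eqVneq j l.
  - by move: eij lij; rewrite il jl => /anti; case: (lt l l).
  - rewrite il in eij lij; apply: (hc j _ eij).1 => //; by rewrite !inE jl jJ.
  - rewrite jl in eij lij; apply: (hc i _ _).2 => //; first by rewrite !inE il iJ.
    by rewrite es.
  - by apply: hh => //; rewrite !inE ?il ?jl ?iJ ?jJ.
have [h hh] := key _ [set: I]%SET erefl.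
(* The shift makes every height nonnegative. *)
exists (fun i => absz (h i + \sum_j `|h j|)) => i j eij lij.
have hE : h j = h i + 1 by apply: hh; rewrite ?finset.in_setT.
have pos l : 0 <= h l + \sum_j `|h j|.
  have : `|h l| <= \sum_j `|h j| by rewrite (bigD1 l) //= lerDl sumr_ge0.
  by lia.
by have := pos i; have := pos j; lia.
Qed.

End Cycles.

(** * The Coxeter diagram and bipartite words *)

Section Diagram.
Set Implicit Arguments.
Unset Strict Implicit.
Variables (R : realType) (n : nat).
Local Notation E := 'rV[R]_n.
Variables (v b : 'I_n.+1 -> E) (c : 'I_n.+1 -> R).
Hypotheses (n0 : (0 < n)%N) (hb : bary v b c).
Local Notation beta i := (aff (b i) (c i)).
Local Notation s := (fun i => refl_map (b i) (c i)).
Local Notation word o := (compl [seq refl_map (b i) (c i) | i <- o]).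
Hypothesis dih : forall i j, i != j -> exists m : nat, (2 <= m)%N /\
  dotp (b i) (b j) = - cos (pi / m%:R) *
    (Num.sqrt (dotp (b i) (b i)) * Num.sqrt (dotp (b j) (b j))).

Let b0 i : b i != 0 := bary_grad_neq0 hb i n0.
Local Notation norm i := (Num.sqrt (dotp (b i) (b i))).
Let normp i : 0 < norm i := norm_gt0 n0 hb i.

Definition adj i j := (i != j) && (dotp (b i) (b j) != 0).

Lemma adj_sym : symmetric adj.
Proof. by move=> i j; rewrite /adj eq_sym dotpC. Qed.

Lemma adj_irr : irreflexive adj.
Proof. by move=> i; rewrite /adj eqxx. Qed.

Lemma not_adj i j : i != j -> ~~ adj i j -> dotp (b i) (b j) = 0.
Proof. by rewrite /adj => -> /negPn/eqP. Qed.

Definition unit_normal i : E := (norm i)^-1 *: b i.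

Lemma dotp_unit i j : dotp (unit_normal i) (unit_normal j) = dotp (b i) (b j) / (norm i * norm j).
Proof.
rewrite /unit_normal dotpZl dotpZr; field.
by rewrite !lt0r_neq0.
Qed.

Lemma dotp_unit_self i : dotp (unit_normal i) (unit_normal i) = 1.
Proof. by rewrite dotp_unit norm_sq divff // dotp_eq0. Qed.

Lemma dotp_unit_le0 i j : i != j -> dotp (unit_normal i) (unit_normal j) <= 0.
Proof.
move=> ij; rewrite dotp_unit; have [m [m2 ->]] := dih ij.
rewrite mulfK ?mulf_neq0 ?lt0r_neq0 // oppr_le0; apply: cos_ge0_pihalf.
have pi0 := pi_gt0 R; have m0 : 0 < (m%:R : R) by rewrite ltr0n; lia.
have m2' : (2 : R) <= m%:R by rewrite ler_nat.
have h : 0 <= pi / m%:R :> R by rewrite divr_ge0 // ltW.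
apply/andP; split; first by apply: le_trans h; rewrite oppr_le0 divr_ge0 // ltW.
by rewrite ler_pM2l // lef_pV2 ?posrE.
Qed.

Lemma dotp_unit_adj i j : adj i j -> dotp (unit_normal i) (unit_normal j) <= - 2^-1.
Proof.
case/andP=> ij bij; rewrite dotp_unit; have [m [m2 e]] := dih ij.
rewrite e mulfK ?mulf_neq0 ?lt0r_neq0 // lerN2; apply: cos_pi_ge.
rewrite ltn_neqAle m2 andbT; apply: contraNneq bij => m2'.
by rewrite e -m2' cos_pihalf oppr0 mul0r.
Qed.

(** By [bary_dep] the relation has equal coefficients on all gradients; one is positive, so every
    index occurs. *)
Lemma unit_normal_dep k (f : 'I_k -> 'I_n.+1) : (0 < k)%N ->
  \sum_a unit_normal (f a) = 0 -> forall i, exists a, f a = i.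
Proof.
move=> k0 S0 i; pose l j := \sum_(a | f a == j) (norm j)^-1.
have ld : \sum_j l j *: b j = 0.
  transitivity (\sum_j \sum_(a | f a == j) unit_normal (f a)); last first.
    by rewrite -[RHS]S0 [RHS](partition_big f xpredT).
  apply: eq_bigr => j _.
  by rewrite scaler_suml; apply: eq_bigr => a /eqP <-.
pose a0 := Ordinal k0.
have l0 : 0 < l (f a0).
  rewrite /l (bigD1 a0) //= ltr_pwDl ?invr_gt0 //.
  by apply: sumr_ge0 => a _; rewrite invr_ge0 ltW.
apply: contrapT => h; move: l0; rewrite (bary_dep hb ld _ i) /l big1 ?ltxx // => a /eqP ai.
by case: h; exists a.
Qed.

Lemma refl_neq i j : i != j -> s i \o s j <> id.
Proof.
move=> ij /(congr1 (fun f => s i (f (v i)))) /=.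
have -> : s j (v i) = v i.
  by apply/Fix_refl => //; rewrite (bary_vert hb) eq_sym (negPf ij).
rewrite refl_mapK // => /esym /(Fix_refl _ _ (b0 i)); rewrite (bary_vert hb) eqxx => /eqP.
by rewrite oner_eq0.
Qed.

Lemma refl_comm i j : dotp (b i) (b j) = 0 -> s i \o s j = s j \o s i.
Proof.
move=> ij; apply/funext => z; have := @alternate_braid _ _ _ _ _ n0 hb i j 2 z.
by rewrite ij cos_pihalf oppr0 mul0r => /(_ erefl erefl).
Qed.

(** As [s j] fixes [v i], commutation makes the [j]-th coordinate of [s i (v i)] equal to its own
    negative. *)
Lemma refl_comm_orth i j : i != j -> s i \o s j = s j \o s i -> dotp (b i) (b j) = 0.
Proof.
move=> ij /(congr1 (fun f => beta j (f (v i)))) /=.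
have -> : s j (v i) = v i.
  by apply/Fix_refl => //; rewrite (bary_vert hb) eq_sym (negPf ij).
rewrite aff_refl_self // => /eqP; rewrite -addr_eq0 -mulr2n mulrn_eq0 /=.
rewrite aff_refl !(bary_vert hb) (eq_sym j) (negPf ij) eqxx mulr1 sub0r oppr_eq0 mulf_eq0.
rewrite mulf_eq0 invr_eq0 pnatr_eq0 dotp_eq0 (negPf (b0 i)) /= dotpC => /eqP //.
Qed.

Lemma order2 i j : i != j -> dotp (b i) (b j) = 0 -> has_order (s i \o s j) 2.
Proof.
move=> ij d; split=> [|[|[|//]] // _]; last exact: refl_neq.
apply/funext => x /=; have /= <- := congr1 (fun f => f (s j x)) (refl_comm d).
by rewrite !refl_mapK.
Qed.

Lemma order3 i j : i != j -> dotp (unit_normal i) (unit_normal j) = - 2^-1 ->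
  has_order (s i \o s j) 3.
Proof.
move=> ij d; have nn : norm i * norm j != 0 by rewrite mulf_neq0 ?lt0r_neq0.
have e : dotp (b i) (b j) = - cos (pi / 3%:R) * (norm i * norm j).
  by rewrite -[LHS](divfK nn) -dotp_unit d cos_pi3.
have br x : s i (s j (s i x)) = s j (s i (s j x)).
  exact: (@alternate_braid _ _ _ _ _ n0 hb i j 3 x erefl e).
have i3 x : s i (s j (s i (s j (s i (s j x))))) = x by rewrite br !refl_mapK.
split; first by apply/funext => x; exact: i3.
move=> [|[|[|//]]] // _; first exact: refl_neq.
move=> i2; apply: (refl_neq ij); apply/funext => x; rewrite /= -[RHS]i3.
exact: (esym (congr1 (fun f => f (s i (s j x))) i2)).
Qed.

Hypothesis notA : ~ type_Atilde s.

(** The squared norm of the sum of unit normals along a cycle is at most zero, so that sum vanishes.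
    The cycle then uses every vertex, with all labels 3, which is the excluded type. *)
Lemma diagram_acyclic x p : uniq (x :: p) -> (1 < size p)%N -> ~~ cycle adj (x :: p).
Proof.
move=> up sp; apply/negP => cyc; apply: notA; right.
set C := x :: p; have kC : size C = (size p).+1 by [].
set k := size C; have k2 : (2 < k)%N by [].
pose f (a : 'I_k) := nth x C a.
have finj : injective f.
  move=> a a' /eqP; rewrite /f nth_uniq ?ltn_ord // => /eqP; exact: val_inj.
have fadj a : adj (f a) (f (ordS a)).
  have /(pathP x) := cyc; rewrite size_rcons => /(_ a (ltn_ord a)).
  rewrite -rcons_cons nth_rcons ltn_ord nth_rcons /f /=.
  have [ap|ap|ap] := ltngtP a (size p).
  - by rewrite modn_small.
  - by exfalso; have := ltn_ord a; rewrite ltnNge => /negP; apply; exact: ap.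
  - by rewrite ap modnn.
pose G a a' := dotp (unit_normal (f a)) (unit_normal (f a')).
have GS : \sum_a \sum_a' G a a' = dotp (\sum_a unit_normal (f a)) (\sum_a unit_normal (f a)).
  by rewrite dotp_suml; apply: eq_bigr => a _; rewrite dotp_sumr.
have [||||| G0 GE] := @cycle_gram R k G k2.
- by move=> a; exact: dotp_unit_self.
- by move=> a a' aa'; apply: dotp_unit_le0; rewrite (inj_eq finj).
- by move=> a a'; rewrite /G dotpC.
- by move=> a; exact: dotp_unit_adj.
- by rewrite GS dotp_ge0.
have S0 : \sum_a unit_normal (f a) = 0.
  by apply/eqP; rewrite -dotp_eq0 -GS G0.
have fsurj := unit_normal_dep (isT : (0 < k)%N) S0.
have kn : k = n.+1.
  apply/eqP; rewrite eqn_leq; apply/andP; split.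
    by have := leq_card f finj; rewrite !card_ord.
  have [g fg] := choice fsurj.
  have gi : injective g by move=> i j gij; rewrite -(fg i) -(fg j) gij.
  by have := leq_card g gi; rewrite !card_ord.
split; first by rewrite -ltnS -kn.
clearbody k; subst k; exists f; split=> // a a' aa'.
have faa' : f a != f a' by rewrite (inj_eq finj).
have := GE a a' aa'; rewrite -!val_eqE /= /cyc_adjacent.
case: ifP => _ g; first exact: order3.
apply: order2 => //; apply/eqP; have := g; rewrite /G dotp_unit => /eqP.
have nn : norm (f a) * norm (f a') != 0 by rewrite mulf_neq0 ?lt0r_neq0.
by rewrite mulf_eq0 invr_eq0 (negPf nn) orbF.
Qed.

Definition height_sorted (h : 'I_n.+1 -> nat) :=
  pairwise (fun i j => adj i j ==> (h j == (h i).+1)).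

Lemma word_to_front o1 i o2 : (forall j, j \in o1 -> j != i /\ ~~ adj j i) ->
  word (o1 ++ i :: o2) = s i \o word (o1 ++ o2).
Proof.
elim: o1 => //= j o1 IH h; have [ji nji] := h j (mem_head _ _).
rewrite IH => [|l lo]; last by apply: h; rewrite inE lo orbT.
apply/funext => x.
exact: (congr1 (fun f => f (word (o1 ++ o2) x)) (refl_comm (not_adj ji nji))).
Qed.

(** The first letter [i] of [o'] can be moved to the front of [o]: a neighbour before it in [o]
    would be lower than [i], yet it follows [i] in [o'] and so is higher. *)
Lemma word_height_sorted h o o' : uniq o -> perm_eq o o' ->
  height_sorted h o -> height_sorted h o' -> word o = word o'.
Proof.
elim: o' o => [|i t IH] o uo po; first by move/perm_nilP: po => ->.
have io : i \in o by rewrite (perm_mem po) mem_head.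
case/splitPr: io uo po => o1 o2 uo po.
rewrite /height_sorted pairwise_cat pairwise_cons => /and3P[h1 h2 /andP[h3 h4]] /andP[h5 h6].
have po' : perm_eq (o1 ++ o2) t by move: po; rewrite perm_catC /= perm_cons perm_catC.
have pp : perm_eq (o1 ++ i :: o2) (i :: o1 ++ o2) by rewrite perm_catC /= perm_cons perm_catC.
have uo' : uniq (i :: o1 ++ o2) by rewrite -(perm_uniq pp).
case/andP: uo' => io uo'.
have e1 : word (o1 ++ i :: o2) = s i \o word (o1 ++ o2).
  apply: word_to_front => j jo; split.
    by apply: contraNneq io => <-; rewrite mem_cat jo.
  apply/negP => ji; have := allrelP h1 j i jo (mem_head _ _); rewrite ji => /eqP e1.
  have jt : j \in t by rewrite -(perm_mem po') mem_cat jo.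
  by have := allP h5 j jt; rewrite adj_sym ji => /eqP; move: e1; clear; lia.
have e2 : word (o1 ++ o2) = word t.
  apply: IH uo' po' _ h6; rewrite /height_sorted pairwise_cat h2 h4 !andbT.
  by apply/allrelP => a a' ao a'o; apply: (allrelP h1) => //; rewrite inE a'o orbT.
by rewrite e1 e2.
Qed.

Lemma adj_height h o i j : (forall l, l \in o) -> height_sorted h o -> adj i j ->
  h j = (h i).+1 \/ h i = (h j).+1.
Proof.
move=> mo so ij; have ji : adj j i by rewrite adj_sym.
have : i != j by case/andP: ij.
have := mo i; have := mo j; elim: o {mo} so => //= l o IH /andP[/allP hl so].
rewrite !inE => /orP[/eqP jl|jo] /orP[/eqP il|io] nij.
- by rewrite il jl eqxx in nij.
- by have := hl i io; rewrite -jl ji => /eqP ->; right.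
- by have := hl j jo; rewrite -il ij => /eqP ->; left.
- exact: IH.
Qed.

Local Notation bipartite_word cl :=
  ([seq i <- enum 'I_n.+1 | cl i == true] ++ [seq i <- enum 'I_n.+1 | cl i == false]).

(* Moving a source to the end of the word conjugates it by a simple reflection; raising
   minimal heights by 2 as long as possible leaves two consecutive heights. *)
Lemma bipartite_conjugate o : perm_eq o (enum 'I_n.+1) ->
  exists g g' (cl : 'I_n.+1 -> bool), [/\ Wgrp s g, Wgrp s g', cancel g g' & cancel g' g] /\
    word o = g \o word (bipartite_word cl) \o g' /\
    forall i j, i != j -> cl i = cl j -> dotp (b i) (b j) = 0.
Proof.
move=> po; have uo : uniq o by rewrite (perm_uniq po) enum_uniq.
have mo i : i \in o by rewrite (perm_mem po) mem_enum.
have [||h hh] := @forest_height _ adj (fun i j => (index i o < index j o)%N) adj_sym.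
- move=> i j /andP[ij _]; rewrite -leqNgt [RHS]leq_eqVlt orb_idl // => /eqP e.
  by move: ij; rewrite -(nth_index i (mo i)) e nth_index ?eqxx.
- move=> J J0; apply: acyclic_leaf => //.
  + exact: adj_sym.
  + exact: adj_irr.
  + exact: diagram_acyclic.
have so : height_sorted h o.
  apply/(pairwiseP ord0) => k l; rewrite !inE => ko lo kl; apply/implyP => /hh ->; rewrite ?eqxx //.
  by rewrite !index_uniq.
pose M := \max_i h i; have hM i : (h i <= M)%N by exact: leq_bigmax.
move: M hM {hh} => M hM.
(* Each move lowers the total deficit below [M] by two. *)
have [N] := ubnP (\sum_i (M - h i)); elim: N o h hM po uo mo so => // N IH o h hM po uo mo so lt.
have [/existsP [i1 hi1]|] := boolP [exists i, (h i).+2 <= M]%N; last first.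
  rewrite negb_exists => /forallP hi.
  have hi' i : h i = M \/ (h i).+1 = M by have := hi i; have := hM i; clear; lia.
  (* Class [true] is the lower of the two remaining heights, since it comes first in the word. *)
  pose cl i := h i != M; exists id, id, cl.
  have clh i j : adj i j -> cl i != cl j.
    move=> /(adj_height mo so); rewrite /cl; have := hi' i; have := hi' j.
    by clear; case: eqP; case: eqP => //; lia.
  split; first by split=> //; exact: gen_id.
  split; last first.
    by move=> i j ij cij; apply: not_adj => //; apply/negP => /clh; rewrite cij eqxx.
  have pb : perm_eq (enum 'I_n.+1) (bipartite_word cl).
    have -> : [seq i <- enum 'I_n.+1 | cl i == false] =
        [seq i <- enum 'I_n.+1 | predC (fun i => cl i == true) i].
      by apply: eq_filter => i /=; case: (cl i).
    by rewrite perm_sym perm_filterC.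
  apply: (@word_height_sorted h) => //; first exact: perm_trans pb.
  have same k (l : seq 'I_n.+1) : pairwise (fun i j => adj i j ==> (h j == (h i).+1))
      [seq i <- l | cl i == k].
    elim: l => //= i l IHl; case: ifP => //= /eqP ci; rewrite IHl andbT.
    apply/allP => j; rewrite mem_filter => /andP[/eqP cj _]; apply/implyP => /clh.
    by rewrite ci cj eqxx.
  rewrite /height_sorted pairwise_cat !same !andbT; apply/allrelP => i j.
  rewrite !mem_filter /cl => /andP[/eqP ci _] /andP[/eqP cj _]; apply/implyP => _.
  by have := hi' i; have := hi' j; move: ci cj; clear; case: eqP; case: eqP => //; lia.
(* A letter of least height is a source. Moved to the end it follows its neighbours, all of height
   [h i + 1], so its new height is [h i + 2]. *)
pose i := [arg min_(j < i1) h j]; have imin j : (h i <= h j)%N.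
  by rewrite /i; case: arg_minnP => // l _; apply.
have hi2 : ((h i).+2 <= M)%N by apply: leq_trans hi1; rewrite !ltnS.
have [ o1 [ o2 oE]] : exists o1 o2, o = o1 ++ i :: o2.
  by case/splitPr: (mo i) => o1 o2; exists o1, o2.
have uo' : uniq (o1 ++ i :: o2) by rewrite -oE.
have := so; rewrite {1}oE /height_sorted pairwise_cat pairwise_cons => /and3P[h1 h2 /andP[h3 h4]].
have po' : perm_eq (o1 ++ i :: o2) (i :: o1 ++ o2) by rewrite perm_catC /= perm_cons perm_catC.
have /andP[io uo12] : uniq (i :: o1 ++ o2) by rewrite -(perm_uniq po').
have noti j : j \in o1 ++ o2 -> j != i by move=> jo; apply: contraNneq io => <-.
pose h' j := if j == i then (h i).+2 else h j.
have pr : perm_eq (rcons (o1 ++ o2) i) o.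
  by rewrite perm_rcons oE perm_sym.
have wE : word o = s i \o word (rcons (o1 ++ o2) i) \o s i.
  rewrite oE; have -> : word (o1 ++ i :: o2) = s i \o word (o1 ++ o2).
    apply: word_to_front => j jo; split; first by apply: noti; rewrite mem_cat jo.
    apply/negP => ji; have := allrelP h1 j i jo (mem_head _ _); rewrite ji => /eqP.
    by have := imin j; clear; lia.
  rewrite -[rcons _ _]cats1 (map_cat _ _ [:: i]) compl_cat.
  by apply/funext => x /=; rewrite refl_mapK.
have [||||||g [g' [cl [[Wg Wg' gK g'K] [wg orth]]]]] := IH (rcons (o1 ++ o2) i) h'.
- by move=> j; rewrite /h'; case: eqP.
- exact: perm_trans po.
- by rewrite (perm_uniq pr).
- by move=> j; rewrite (perm_mem pr).
- rewrite /height_sorted pairwise_rcons; apply/andP; split.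
    apply/allP => j jo; apply/implyP => ji; rewrite /h' eqxx (negPf (noti j jo)).
    move: jo; rewrite mem_cat => /orP[jo|jo].
      have := allrelP h1 j i jo (mem_head _ _); rewrite ji => /eqP.
      by have := imin j; clear; lia.
    by have := allP h3 j jo; rewrite adj_sym ji => /eqP ->.
  have : pairwise (fun i j => adj i j ==> (h j == (h i).+1)) (o1 ++ o2).
    rewrite pairwise_cat h2 h4 !andbT.
    by apply/allrelP => a a' ao a'o; apply: (allrelP h1) => //; rewrite inE a'o orbT.
  apply: (sub_in_pairwise (P := [pred j | j != i])); last exact/allP.
  by move=> a a'; rewrite !inE /h' => /negPf -> /negPf ->.
- rewrite -ltnS; apply: leq_ltn_trans lt.
  rewrite (bigD1 i) //= [X in (_ < X)%N](bigD1 i) //= /h' eqxx.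
  rewrite (eq_bigr (fun j => (M - h j)%N)) => [|j /negPf -> //].
  by rewrite ltn_add2r; move: hi2; clear; lia.
exists (s i \o g), (g' \o s i), cl; split; [split | by rewrite wE wg].
- by apply: gen_comp Wg; exact: W_gen.
- by apply: gen_comp Wg' _; exact: W_gen.
- by move=> x /=; rewrite refl_mapK.
- by move=> x /=; rewrite g'K refl_mapK.
Qed.

End Diagram.

(** * Change of chamber *)

Section Transport.
Set Implicit Arguments.
Unset Strict Implicit.
Variables (R : realType) (n : nat).
Local Notation E := 'rV[R]_n.

Lemma R0_congr (s r : 'I_n.+1 -> E -> E) : Wgrp s = Wgrp r -> R0 s = R0 r.
Proof.
move=> e; have er : reflection_of s = reflection_of r.
  by apply/funext => t; rewrite /reflection_of e.
by apply/funext => w; apply/funext => t; rewrite /R0 /min_refl_factorization /refl_factorization er.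
Qed.

Lemma compl_conj (T : Type) (g g' : T -> T) (l : seq (T -> T)) : cancel g g' -> cancel g' g ->
  compl [seq g \o f \o g' | f <- l] = g \o compl l \o g'.
Proof.
move=> gK g'K; elim: l => [|f l IH] /=; first by apply/funext => x /=; rewrite g'K.
by rewrite IH; apply/funext => x /=; rewrite gK.
Qed.

(** The gradient of a barycentric coordinate is an inward normal of its facet, so the angle
    condition applies to it. *)
Lemma dihedral_grad (v b : 'I_n.+1 -> E) (c : 'I_n.+1 -> R) : (0 < n)%N -> bary v b c ->
  dihedral_submultiples v -> forall i j, i != j -> exists m : nat, (2 <= m)%N /\
  dotp (b i) (b j) = - cos (pi / m%:R) *
    (Num.sqrt (dotp (b i) (b i)) * Num.sqrt (dotp (b j) (b j))).
Proof.
move=> n0 hb dih i j ij.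
have normal l : facet_normal v l (b l).
  have e k : dotp (b l) (v k) = (l == k)%:R + c l by rewrite -(bary_vert hb) subrK.
  split; first exact: (bary_grad_neq0 hb).
  split=> [k k' kl k'l|k kl]; rewrite !e eq_sym (negPf kl).
    by rewrite eq_sym (negPf k'l).
  by rewrite eqxx ltrD2r ltr01.
have [m [m2 h]] := dih i j ij; exists m; split=> //.
by rewrite (h _ _ (normal i) (normal j)) sqrtrM // dotp_ge0.
Qed.

Variables (v b : 'I_n.+1 -> E) (c : 'I_n.+1 -> R).
Hypotheses (n0 : (0 < n)%N) (hb : bary v b c).
Local Notation s := (fun i => refl_map (b i) (c i)).

Section Image.
Variables (g g' : E -> E) (b' : 'I_n.+1 -> E) (c' : 'I_n.+1 -> R).
Hypotheses (Wg : Wgrp s g) (Wg' : Wgrp s g') (gK : cancel g g') (g'K : cancel g' g).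
Hypothesis hb' : bary (g \o v) b' c'.
Local Notation r := (fun i => refl_map (b' i) (c' i)).

Lemma image_refl i : r i = g \o s i \o g'.
Proof.
apply/esym/(bary_facet_refl hb' i _ n0).
have [_ fix_s] := (bary_facet_refl hb i _ n0).2 erefl.
split=> [|j ji]; last by rewrite /= gK fix_s.
have [a [k [e a0 _]]] := refl_conj (b i) (c i) (W_rigid n0 hb Wg') g'K.
by exists a, k; split=> //; apply: a0; exact: (bary_grad_neq0 hb).
Qed.

(** The new facet reflections are conjugates of the old ones by a group element, so any chamber of
    the orbit can serve as the base chamber. *)
Lemma image_Wgrp : Wgrp s = Wgrp r.
Proof.
have conj f : Wgrp s f -> Wgrp r (g \o f \o g').
  elim=> [|h f' [i ->] _ IH].
    have -> : g \o id \o g' = id by apply/funext => x /=; rewrite g'K.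
    exact: gen_id.
  have -> : g \o (s i \o f') \o g' = r i \o (g \o f' \o g').
    by rewrite image_refl; apply/funext => x /=; rewrite gK.
  by apply: gen_comp IH; apply: gen1; exists i.
apply/funext => f; apply/propext; split=> [Wf|].
  have -> : f = g \o (g' \o f \o g) \o g' by apply/funext => x /=; rewrite !g'K.
  by apply: conj; apply: gen_comp Wg; apply: gen_comp Wf.
elim=> [|h f' [i ->] _ IH]; first exact: gen_id.
apply: gen_comp IH; rewrite image_refl; apply: gen_comp Wg'; apply: gen_comp Wg _.
exact: W_gen.
Qed.

Lemma image_sign :
  (forall a k, a != 0 -> Wgrp s (refl_map a k) ->
    (forall j, 0 <= aff a k (v j)) \/ (forall j, aff a k (v j) <= 0)) ->
  forall a k, a != 0 -> Wgrp r (refl_map a k) ->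
    (forall j, 0 <= aff a k ((g \o v) j)) \/ (forall j, aff a k ((g \o v) j) <= 0).
Proof.
move=> sign a k a0; rewrite -image_Wgrp => Wt.
have [a1 [k1 [e a10 fE]]] := refl_conj a k (W_rigid n0 hb Wg) gK.
have [||h|h] := sign a1 k1; first exact: a10.
- by rewrite -e; apply: gen_comp Wg; apply: gen_comp Wt.
- by left=> j; rewrite /= fE.
- by right=> j; rewrite /= fE.
Qed.

Lemma image_proper : acts_properly s -> acts_properly r.
Proof. by rewrite /acts_properly -image_Wgrp. Qed.

Lemma image_word o : compl [seq r i | i <- o] = g \o compl [seq s i | i <- o] \o g'.
Proof.
rewrite -compl_conj // -map_comp; congr compl; apply: eq_map => i /=.
exact: image_refl.
Qed.

End Image.
End Transport.

Theorem theorem9p6 (R : realType) (n : nat) (v : 'I_n.+1 -> 'rV[R]_n)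
  (s : 'I_n.+1 -> 'rV[R]_n -> 'rV[R]_n) :
  (0 < n)%N ->
  affinely_independent v ->
  (forall i, facet_reflection v i (s i)) ->
  dihedral_submultiples v ->
  acts_properly s -> acts_cocompactly s ->
  ~ type_Atilde s ->
  forall w : 'rV[R]_n -> 'rV[R]_n, coxeter_element v s w ->
  (exists g r b x0 x1 X, axial_setup v s w g r b x0 x1 X) /\
  (forall g r b x0 x1 X, axial_setup v s w g r b x0 x1 X ->
   forall rr : 'rV[R]_n -> 'rV[R]_n, reflection_of s rr ->
     (R0 s w rr <-> exists y, axial_vertex v g r b X y /\ Fix rr y)).
Proof.
move=> n0 /bary_exists [b [c hb]] hs dih proper _ notA w cox.
have sE : s = fun i => refl_map (b i) (c i).
  by apply/funext => i; apply/(bary_facet_refl hb i _ n0).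
subst s; have {}dih := dihedral_grad n0 hb dih.
have sign := refl_sign n0 hb dih proper.
split.
  have [g [Wg [r [ o [hr [po wE]]]]]] := cox.
  have [g' [Wg' gK g'K]] := W_inv n0 hb Wg.
  have [b1 [c1 [hb1 _]]] := bary_rigid hb (W_rigid n0 hb Wg).
  have rE : r = fun i => refl_map (b1 i) (c1 i).
    by apply/funext => i; apply/(bary_facet_refl hb1 i _ n0).
  (* The bipartite word is found on the base chamber; [g \o h] carries that chamber to one on which
     [w] itself is bipartite. *)
  have [h [h' [cl [[Wh Wh' hK h'K] [ oE orth]]]]] := bipartite_conjugate n0 hb dih notA po.
  have Wgh := gen_comp Wg Wh; have Wgh' := gen_comp Wh' Wg'.
  have ghK : cancel (g \o h) (h' \o g') by move=> x /=; rewrite gK hK.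
  have ghK' : cancel (h' \o g') (g \o h) by move=> x /=; rewrite h'K g'K.
  have [b2 [c2 [hb2 [dE _]]]] := bary_rigid hb (W_rigid n0 hb Wgh).
  have orth2 i j : i != j -> cl i = cl j -> dotp (b2 i) (b2 j) = 0.
    by move=> ij cij; rewrite dE; exact: orth.
  have [x0 [x1 [X [[x0f x1f x1E X0 X1] [Xn Xr]]]]] := axial_points_exist n0 hb2 orth2.
  exists (g \o h), (fun i => refl_map (b2 i) (c2 i)), cl, x0, x1, X.
  split=> //; split; first by move=> i; apply/(bary_facet_refl hb2 i _ n0).
  split.
    move=> i j ij nc; apply/eqP => cij; apply: nc.
    exact: (refl_comm n0 hb2 (orth2 i j ij cij)).
  split.
    rewrite -word_oo (image_word n0 hb Wgh' ghK ghK' hb2) wE rE.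
    by rewrite (image_word n0 hb Wg' gK g'K hb1) oE.
  rewrite /Fface !(aff_hull_face n0 hb2 cl).
  split; first exact: x0f.
  split; first exact: x1f.
  split; first exact/(flat_closest n0 hb2 orth2 x0f x1f).
  by [].
move=> g r cl x0 x1 X [Wg [hr [bip [wE [hx0 [hx1 [hmin [X0 [X1 [Xn Xr]]]]]]]]]] t tr.
have [g' [Wg' gK g'K]] := W_inv n0 hb Wg.
have [b1 [c1 [hb1 _]]] := bary_rigid hb (W_rigid n0 hb Wg).
have rE : r = fun i => refl_map (b1 i) (c1 i).
  by apply/funext => i; apply/(bary_facet_refl hb1 i _ n0).
subst r.
(* The setup makes reflections of one class commute, which means orthogonal gradients. *)
have orth1 i j : i != j -> cl i = cl j -> dotp (b1 i) (b1 j) = 0.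
  move=> ij cij; apply: (refl_comm_orth n0 hb1 ij); apply: contrapT => nc.
  by have := bip i j ij nc; rewrite cij eqxx.
have WE := image_Wgrp n0 hb Wg Wg' gK g'K hb1.
move: hx0 hx1 hmin; rewrite /Fface !(aff_hull_face n0 hb1 cl) => x0f x1f.
move/(flat_closest n0 hb1 orth1 x0f x1f) => x1E.
have sign1 := image_sign n0 hb Wg Wg' gK g'K hb1 sign.
have proper1 := image_proper n0 hb Wg Wg' gK g'K hb1 proper.
have tr1 : reflection_of (fun i => refl_map (b1 i) (c1 i)) t by rewrite /reflection_of -WE.
rewrite (R0_congr WE) wE -word_oo.
rewrite (R0_on_axis n0 hb1 orth1 sign1 proper1 x0f x1f x1E tr1).
have av := axial_vertexP n0 hb1 orth1 x0f x1f x1E X0 X1 Xn Xr.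
by split=> -[y [hy ty]]; exists y; split=> //; apply/av.
Qed.
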